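(* Let $X$ be a locally compact, separable, completely metrizable topological space and let $\mathcal{P}$ be a closed set (in the closed convergence topology) of locally strict preferences on $X$. Let $\lambda$ be a Borel probability measure on $X$ with full support such that, for all $\succeq\,\in\mathcal{P}$, the set $\{(x,y):x\sim y\}$ has $\lambda\otimes\lambda$-probability $0$, and let $q$ be an error probability function. Suppose the subject's preference is $\succeq^*\in\mathcal{P}$. Let $\succeq_n$ denote the Kemeny-minimizing estimator for the $n$-th (random) experiment $\Sigma_n$. Then $\{\succeq_n\}_{n\in\mathbb{N}}$ converges to $\succeq^*$ in probability; that is, for any $\eta>0$, $$\lim_{n\to\infty}\Pr\big(\rho(\succeq_n,\succeq^* )<\eta\big)=1 .$$
   Context: A preference on $X$ is a binary relation $\succeq\,\subseteq X\times X$ that is complete and continuous (closed in $X\times X$); transitivity is not required. $x\succ y$ means $x\succeq y$ and not $y\succeq x$; $x\sim y$ means $x\succeq y$ and $y\succeq x$. $\succeq$ is locally strict if for all $x\succeq y$ and every neighborhood $V$ of $(x,y)$ in $X\times X$ there is $(x',y')\in V$ with $x'\succ y'$. Closed convergence: $\succeq_n\to\succeq^*$ means (1) for all $x^*\succeq^* y^*$ there are $(x_n,y_n)\to(x^*,y^* )$ with $x_n\succeq_n y_n$ for all $n$; and (2) for every subsequence $\{\succeq_{n_k}\}_k$ and every limit $(x^*,y^* )$ of pairs with $x_{n_k}\succeq_{n_k}y_{n_k}$ for all $k$, $x^*\succeq^*y^*$. For $X$ as in the claim, this is convergence in the (metrizable) closed convergence topology on continuous binary relations (closed subsets of $X\times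 X$). $\rho$ is a fixed metric compatible with this topology. An error probability function is $q:\mathcal{P}\times X\times X\to[0,1]$ such that $q(\succeq;\cdot,\cdot)$ is measurable for each $\succeq\,\in\mathcal{P}$ and $x\succ y$ implies $q(\succeq;x,y)>1/2$. A subject with preference $\succeq$ facing $\{x,y\}$ chooses $x$ with probability $q(\succeq;x,y)$ and $y$ with the complementary probability (so $q(\succeq;y,x)=1-q(\succeq;x,y)$ for $x\ne y$); no assumption is made when $x\sim y$. The experiment $\Sigma_n=\{B_1,\dots,B_n\}$ consists of problems $B_k=\{x_k,y_k\}$ where all $x_k,y_k$ ($k\ge1$) are drawn i.i.d. from $\lambda$; the subject's choices are then drawn, independently across problems, according to $q(\succeq^*;\cdot,\cdot)$. The revealed relation $R_n$ is the set of $(x,y)$ with $\{x,y\}\in\Sigma_n$ and $x$ chosen from $\{x,y\}$. The Kemeny-minimizing estimator $\succeq_n$ is any element of $\arg\min\{d_n(\succeq,R_n):\succeq\,\in\mathcal{P}\}$, where $d_n(\succeq,R_n)=\frac1n|R_n\setminus\succeq|$ and $|\cdot|$ is cardinality. *)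

(* Defs.v *)
From HB Require Import structures.
From mathcomp Require Import all_boot all_order all_algebra finmap.
From mathcomp Require Import all_classical all_reals all_analysis.

Set Implicit Arguments.
Unset Strict Implicit.
Unset Printing Implicit Defensive.

Import Order.TTheory GRing.Theory Num.Theory.
Import numFieldNormedType.Exports.

Local Open Scope classical_set_scope.
Local Open Scope ring_scope.

Section metrics.
Context {R : realType}.

Definition is_metric {T : Type} (d : T -> T -> R) : Prop :=
  [/\ forall x y, 0 <= d x y,
      forall x y, d x y = 0 <-> x = y,
      forall x y, d x y = d y x &
      forall x y z, d x z <= d x y + d y z].

Definition compatible_metric {T : topologicalType} (d : T -> T -> R) : Prop :=
  is_metric d /\
  forall U : set T, open U <->
    forall x, U x -> exists2 e : R, 0 < e & forall y, d x y < e -> U y.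

Definition complete_metric {T : Type} (d : T -> T -> R) : Prop :=
  forall u : nat -> T,
    (forall e : R, 0 < e -> exists N : nat,
       forall m n, (N <= m)%N -> (N <= n)%N -> d (u m) (u n) < e) ->
    exists l, (d (u n) l) @[n --> \oo] --> (0 : R).

End metrics.

Definition completely_metrizable (R : realType) (T : topologicalType) : Prop :=
  exists d : T -> T -> R, compatible_metric d /\ complete_metric d.

Definition separable (T : topologicalType) : Prop :=
  exists2 D : set T, countable D & dense D.

Section closed_convergence.
Context {X : topologicalType}.

(* A continuous binary relation, i.e. a closed subset of X * X. *)
Record crel := Crel { graph : set (X * X); graph_closed : closed graph }.

Definition relates (F : crel) (x y : X) : Prop := graph F (x, y).

(* Convergence F_n -> F; phi enumerates the indices of a subsequence. *)
Definition closed_converges (u : nat -> crel) (F : crel) : Prop :=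
  (forall z, graph F z -> exists zn : nat -> X * X,
     (forall n, graph (u n) (zn n)) /\ zn n @[n --> \oo] --> z) /\
  (forall (phi : nat -> nat) (zk : nat -> X * X) (z : X * X),
     increasing_seq phi -> (forall k, graph (u (phi k)) (zk k)) ->
     zk k @[k --> \oo] --> z -> graph F z).

Definition cc_open (U : set crel) : Prop :=
  forall (u : nat -> crel) (F : crel),
    closed_converges u F -> U F -> \forall n \near \oo, U (u n).

Let cc_openT : cc_open setT.
Proof. by move=> u F _ _; near=> n. Unshelve. all: by end_near. Qed.

Let cc_openI : setI_closed cc_open.
Proof.
move=> U V oU oV u F uF [UF VF].
by apply: filterI; [exact: (oU u F)|exact: (oV u F)].
Qed.

Let cc_open_bigcup (I : Type) (f : I -> set crel) :
  (forall i, cc_open (f i)) -> cc_open (\bigcup_i f i).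
Proof.
move=> fo u F uF [i _ fiF]; apply: filterS (fo i u F uF fiF) => n fin.
by exists i.
Qed.

HB.instance Definition _ := gen_eqMixin crel.
HB.instance Definition _ := gen_choiceMixin crel.

(* The closed convergence topology: a set is open when every sequence that
   closed-converges to one of its elements is eventually in it.  When X is
   locally compact, separable and metrizable, closed convergence of relations
   is convergence for a metrizable topology; a metrizable topology is
   determined by its convergent sequences, so it is this one. *)
HB.instance Definition _ :=
  isOpenTopological.Build crel cc_openT cc_openI cc_open_bigcup.

Lemma crel_openE (U : set crel) : open U <-> cc_open U.
Proof.
split; last by move=> oU; rewrite openE => F UF; exists U; split.
move=> + u F uF UF; rewrite openE => oU; have [V [oV VF VU]] := oU F UF.
by apply: filterS (oV u F uF VF) => n; exact: VU.
Qed.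

End closed_convergence.

Arguments crel : clear implicits.
Coercion relates : crel >-> Funclass.

Section preferences.
Context {X : topologicalType}.
Implicit Types F : crel X.

(* Continuity is part of the type crel X. *)
Definition preference F : Prop := forall x y, F x y \/ F y x.

Definition strictly F (x y : X) : Prop := F x y /\ ~ F y x.

Definition indifferent F (x y : X) : Prop := F x y /\ F y x.

Definition locally_strict F : Prop :=
  forall x y, F x y -> forall V, nbhs (x, y) V ->
    exists x' y', V (x', y') /\ strictly F x' y'.

End preferences.

(* X with its Borel sigma-algebra.  Measurable types are pointed in the
   library; this is no restriction for X, which carries a probability. *)
Notation borel X := (g_sigma_algebraType (@open X)).

Definition full_support (R : realType) (X : ptopologicalType)
    (lambda : probability (borel X) R) : Prop :=
  forall U : set X, open U -> U !=set0 -> (0 < lambda U)%E.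

(* For X separable and metrizable, the product sigma-algebra on
   borel X * borel X is the Borel sigma-algebra of X * X. *)
Definition error_probability (R : realType) (X : ptopologicalType)
    (P : set (crel X)) (q : crel X -> X -> X -> R) : Prop :=
  forall F, P F ->
  [/\ measurable_fun [set: borel X * borel X] (fun z => q F z.1 z.2),
      forall x y, 0 <= q F x y <= 1,
      forall x y, strictly F x y -> 1 / 2 < q F x y &
      forall x y, x <> y -> q F y x = 1 - q F x y].

Section experiment.
Context {R : realType} {X : ptopologicalType} {d : measure_display}
  {Omega : measurableType d} (Pr : probability Omega R).

Definition mutually_independent {d' : measure_display}
    {T : measurableType d'} {I : choiceType} (Z : I -> Omega -> T) : Prop :=
  forall (J : {fset I}) (A : I -> set T), (forall i, measurable (A i)) ->
    Pr (\bigcap_(i in [set` J]) Z i @^-1` A i) =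
    (\prod_(i <- J) Pr (Z i @^-1` A i))%E.

Definition iid {d' : measure_display} {T : measurableType d'} {I : choiceType}
    (Z : I -> {RV Pr >-> T}) (lambda : probability T R) : Prop :=
  mutually_independent (fun i => Z i : Omega -> T) /\
  forall i A, measurable A -> distribution Pr (Z i) A = lambda A.

Variables x y : nat -> {RV Pr >-> borel X}.
(* c k w = true when x k w is chosen from the k-th problem. *)
Variable c : nat -> {RV Pr >-> bool}.

Definition draws (i : nat + nat) : {RV Pr >-> borel X} :=
  match i with inl k => x k | inr k => y k end.

Definition sigma_draws : set (set Omega) :=
  <<s \bigcup_i preimage_set_system setT (draws i : Omega -> borel X)
        measurable >>.

(* Given all the draws, the choices are independent, and x k is chosen from
   the k-th problem with probability p (x k) (y k). *)
Definition choices_drawn (p : X -> X -> R) : Prop :=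
  forall (n : nat) (s : nat -> bool) (E : set Omega), sigma_draws E ->
    Pr (E `&` [set w | forall k, (k < n)%N -> c k w = s k]) =
    (\int[Pr]_(w in E)
       (\prod_(k < n) (if s k then p (x k w) (y k w)
                       else 1 - p (x k w) (y k w)))%:E)%E.

Definition revealed (n : nat) (w : Omega) : set (X * X) :=
  [set z | exists2 k, (k < n)%N &
     z = if c k w then (x k w, y k w) else (y k w, x k w)].

End experiment.

Definition kemeny_distance (R : realType) (X : ptopologicalType) (n : nat)
    (F : crel X) (A : set (X * X)) : R :=
  #|` fset_set (A `\` graph F)|%:R / n%:R.

Definition kemeny_minimizing (R : realType) (X : ptopologicalType)
    (P : set (crel X)) (n : nat) (A : set (X * X)) (F : crel X) : Prop :=
  P F /\ forall G, P G -> kemeny_distance R n F A <= kemeny_distance R n G A.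

(* An arbitrary selection of minimizers need not be measurable, so that the
   probability of an event about it is taken to be its inner probability; on
   measurable events this is the probability itself. *)
Definition inner_probability (R : realType) (d : measure_display)
    (Omega : measurableType d) (Pr : probability Omega R) (A : set Omega) :
    \bar R :=
  ereal_sup [set Pr E | E in [set E | measurable E /\ E `<=` A]].

Lemma inner_probabilityE (R : realType) (d : measure_display)
    (Omega : measurableType d) (Pr : probability Omega R) (A : set Omega) :
  measurable A -> inner_probability Pr A = Pr A.
Proof.
move=> mA; apply/eqP; rewrite eq_le; apply/andP; split.
  apply: ge_ereal_sup => _ [E [mE EA] <-].
  by apply: le_measure => //; rewrite ?inE.
by apply: ereal_sup_ubound; exists A => //; split=> //; exact: subset_refl.
Qed.

(* Main.v *)
(** A preference F errs on an observed choice when it does not contain the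
    (chosen, rejected) pair, and the Kemeny distance is the empirical frequency
    of errors, because lambda is atomless (the diagonal consists of indifferent
    pairs) and almost surely no problem repeats.  Its expectation is the
    probability [choice_law] of the complement of F, and it is minimized over P
    at Fstar only: where F and Fstar rank a pair strictly and oppositely, F errs
    with the larger of the two choice probabilities, and by local strictness
    such pairs contain a nonempty open set, of positive probability.

    To compare Fstar with all distant F at once, exhaust the complement of F
    by finite unions A of basic open sets; some A has larger probability than
    the complement of Fstar, and every G disjoint from A errs at least as often
    as the chosen pair falls in A.  The set of distant preferences is
    sequentially compact for closed convergence, so finitely many sets A
    suffice, and the weak law of large numbers applies to each of them. *)

Require Import Defs.
From HB Require Import structures.
From mathcomp Require Import all_boot all_order all_algebra finmap.
From mathcomp Require Import all_classical all_reals all_analysis.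
From mathcomp Require Import measurable_realfun ring lra.

Import Order.TTheory GRing.Theory Num.Theory.
Import numFieldNormedType.Exports.

Local Open Scope classical_set_scope.
Local Open Scope ring_scope.

Set Implicit Arguments.
Unset Strict Implicit.

(** * Compactness of closed convergence *)

Definition countable_base {T : topologicalType} (B : nat -> set T) : Prop :=
  (forall i, open (B i)) /\
  forall (x : T) (U : set T), open U -> U x -> exists2 i, B i x & B i `<=` U.

Lemma open_metric_ball (R : realType) (T : topologicalType) (d : T -> T -> R)
  (dT : compatible_metric d) (a : T) (e : R) : open [set y | d a y < e].
Proof.
have [[_ _ _ dtri] dopen] := dT; apply/dopen => x /= dax.
exists (e - d a x); first by rewrite subr_gt0.
move=> y dxy; apply: le_lt_trans (dtri a x y) _.
by rewrite addrC -ltrBrDr.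
Qed.

(** The balls of radius [1/(m+1)] around points of the dense set suffice: with [1/(m+1) < e/2] and a
    center that close to [x], the ball stays within [e] of [x]. *)
Lemma separable_countable_base (R : realType) (T : topologicalType)
  (d : T -> T -> R) : compatible_metric d -> separable T ->
  exists B : nat -> set T, countable_base B.
Proof.
move=> dT [D /countable_injP [f finj] Ddense].
have [[d0 deq dsym dtri] dopen] := dT.
(* [f] numbers the points of [D]; [B0 (n, m)] is the ball around the point numbered [n], empty when
   there is no such point. *)
pose B0 (nm : nat * nat) : set T :=
  [set z | exists a, [/\ D a, f a = nm.1 & d a z < nm.2.+1%:R^-1]].
exists (fun i => B0 (odflt (0, 0)%N (choice.unpickle i))); split.
  move=> i; case: (odflt _ _) => n m.
  have -> : B0 (n, m) =
      \bigcup_(a in [set a | D a /\ f a = n]) [set z | d a z < m.+1%:R^-1].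
    by apply/seteqP; split=> [z [a []]|z [a [? ?] ?]]; exists a.
  by apply: bigcup_open => a _; exact: open_metric_ball.
move=> x U oU Ux; have [e e0 eU] := (dopen U).1 oU x Ux.
have [m me] : exists m : nat, m.+1%:R^-1 < e / 2.
  have e20 : 0 < e / 2 by rewrite divr_gt0.
  have [m] := ltr_add_invr e20; rewrite add0r => ?; by exists m.
have [a [da Da]] : [set y | d x y < m.+1%:R^-1] `&` D !=set0.
  apply: Ddense; last exact: open_metric_ball.
  by exists x => /=; rewrite (deq x x).2// invr_gt0.
exists (choice.pickle (f a, m)); rewrite choice.pickleK /=.
  by exists a; split => //; rewrite dsym.
move=> z [a' [Da' /= faa' dz]]; have aa' : a' = a by apply: finj; rewrite ?inE.
apply: eU; apply: le_lt_trans (dtri x a z) _.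
by rewrite (splitr e) ltrD// (lt_trans _ me)// -aa'.
Qed.

Lemma open_rectangle (T1 T2 : topologicalType) (U : set T1) (V : set T2) :
  open U -> open V -> open (U `*` V).
Proof.
move=> oU oV; rewrite openE => -[x y] [/= Ux Vy].
by exists (U, V) => //=; split; exact: open_nbhs_nbhs.
Qed.

Lemma prod_countable_base (T1 T2 : topologicalType) (B1 : nat -> set T1)
    (B2 : nat -> set T2) :
  countable_base B1 -> countable_base B2 ->
  exists f : nat -> nat * nat,
    countable_base (fun i => B1 (f i).1 `*` B2 (f i).2).
Proof.
move=> [oB1 b1] [oB2 b2].
exists (fun i => odflt (0, 0)%N (choice.unpickle i)); split.
  by move=> i; apply: open_rectangle.
move=> [x y] W oW Wxy; have : nbhs (x, y) W by exact: open_nbhs_nbhs.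
move=> [[/= U V] [/= nU nV] UV].
move: nU nV; rewrite !nbhsE => -[U' [oU' U'x] U'U] [V' [oV' V'y] V'V].
have [i B1i iU] := b1 _ _ oU' U'x.
have [j B2j jV] := b2 _ _ oV' V'y.
exists (choice.pickle (i, j)); rewrite choice.pickleK//=.
by move=> [a b] [/= /iU/U'U ? /jV/V'V ?]; apply: UV.
Qed.

(* Along an ultrafilter finer than \oo every v ^~ i has a limit p i. *)
Lemma eventually_constant_subsequence (v : nat -> nat -> bool) :
  exists (phi : nat -> nat) (p : nat -> bool), increasing_seq phi /\
    forall k i, (i < k)%N -> v (phi k) i = p i.
Proof.
have [G [GU ooG]] := ultraFilterLemma (eventually_filter : ProperFilter _).
have GP : ProperFilter G by case: GU.
pose p i : bool := `[< G [set n | v n i] >].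
have Gp i : G [set n | v n i = p i].
  rewrite /p; case: asboolP => [//|nG].
  have [//|] := in_ultra_setVsetC [set n | v n i] GU.
  by apply: filterS => n /= /negP/negbTE.
have Gk k : G [set n | forall i, (i < k)%N -> v n i = p i].
  elim: k => [|k IH]; first by apply: filterS filterT.
  apply: filterS (filterI IH (Gp k)) => n [/= vn vk] i.
  by rewrite ltnS leq_eqVlt => /predU1P[->//|]; exact: vn.
(* A set of [G] meets every tail of the indices, so the next index can always be taken larger. *)
have ex k N : exists n, (N < n)%N /\ forall i, (i < k)%N -> v n i = p i.
  have : G [set n | (N < n)%N] by apply: ooG; exists N.+1.
  by move=> /(filterI (Gk k)) /filter_ex [n [/= vn Nn]]; exists n.
have [g gP] : {g : nat -> nat -> nat | forall k N, (N < g k N)%N /\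
    forall i, (i < k)%N -> v (g k N) i = p i}.
  exists (fun k N => projT1 (cid (ex k N))) => k N.
  exact: projT2 (cid (ex k N)).
pose phi := fix phi k := if k is k'.+1 then g k (phi k') else g 0 0.
exists phi, p; split.
  by apply/increasing_seqP => k /=; have [] := gP k.+1 (phi k).
by move=> [|k] i // ik; have [_] := gP k.+1 (phi k); apply.
Qed.

Lemma increasing_seq_ge (phi : nat -> nat) : increasing_seq phi ->
  forall k, (k <= phi k)%N.
Proof.
move=> /increasing_seqP incphi; elim=> // k IH.
exact: leq_ltn_trans IH (incphi k).
Qed.

(** A diagonal subsequence decides each basic set: from some index on, either all graphs meet it or
    all miss it. The limit is what remains after removing the missed sets, whose indices form [p].
    Nonempty graphs allow approximating sequences that are defined at every index. *)
Lemma closed_limit (X : topologicalType) (B : nat -> set (X * X))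
    (Bbase : countable_base B) (u : nat -> crel X)
    (u0 : forall n, graph (u n) !=set0) :
  exists (phi : nat -> nat) (F : crel X) (p : set nat),
    [/\ increasing_seq phi, closed_converges (fun k => u (phi k)) F,
        ~` graph F = \bigcup_(i in p) B i &
        forall i k, p i -> (i < k)%N -> graph (u (phi k)) `&` B i = set0].
Proof.
have [oB bB] := Bbase.
have [phi [p [iphi phiP]]] := eventually_constant_subsequence
  (fun n i => `[< graph (u n) `&` B i !=set0 >]).
have disj i k : ~~ p i -> (i < k)%N -> graph (u (phi k)) `&` B i = set0.
  move=> npi ik; apply/eqP; apply: contraNT npi => /set0P ne.
  by rewrite -(phiP _ _ ik); apply/asboolP.
have meet i k : p i -> (i < k)%N -> graph (u (phi k)) `&` B i !=set0.
  by move=> pi ik; apply/asboolP; rewrite phiP.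
have cF : closed (~` \bigcup_(i in [set i | ~~ p i]) B i).
  by rewrite closedC; apply: bigcup_open.
exists phi, (Crel cF), [set i | ~~ p i]; split => //=; last by rewrite setCK.
split => /=.
- move=> z /= Fz.
  have pz i : B i z -> p i.
    by move=> Biz; apply/negPn/negP => npi; apply: Fz; exists i.
  (* The sets [U m] form a decreasing neighborhood base at [z]. *)
  pose U m := \bigcap_(i in [set i | (i < m)%N /\ B i z]) B i.
  have meetU m : \forall k \near \oo, graph (u (phi k)) `&` U m !=set0.
    have nU : nbhs z (U m).
      elim: m => [|m IH]; first by apply: filterS filterT => y _ i [].
      have nm : nbhs z [set y | B m z -> B m y].
        have [Bm|nBm] := pselect (B m z).
          have := open_nbhs_nbhs (conj (oB m) Bm).
          by apply: filterS => y By.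
        by apply: filterS filterT => y _ /nBm.
      apply: filterS (filterI IH nm) => y [Uy By] i [/= + Biz].
      rewrite ltnS leq_eqVlt => /predU1P[im|im]; first by subst i; exact: By.
      exact: Uy.
    move: nU; rewrite nbhsE => -[W [oW Wz] WU].
    have [i Biz iW] := bB _ _ oW Wz.
    exists i.+1 => // k /= ik.
    have [y [uy By]] := meet i k (pz _ Biz) ik.
    by exists y; split => //; apply/WU/iW.
  (* The point is taken in [U m] for the largest [m <= n] whose [U m] the graph meets; [m = 0]
     always qualifies, [U 0] being the whole space. *)
  have sel n : {y | graph (u (phi n)) y /\ forall m, (m <= n)%N ->
      graph (u (phi n)) `&` U m !=set0 -> U m y}.
    apply: cid.
    pose Q (m : nat) := (m <= n)%N && `[< graph (u (phi n)) `&` U m !=set0 >].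
    have exQ : exists m, Q m.
      exists 0%N; rewrite /Q leq0n; apply/asboolP.
      by have [y uy] := u0 (phi n); exists y; split => // i [].
    have leQ m : Q m -> (m <= n)%N by case/andP.
    have [m /andP[mn /asboolP[y [uy Uy]]] mmax] := ex_maxnP exQ leQ.
    exists y; split => // m' m'n m'U i [im' Biz]; apply: Uy; split => //=.
    apply: leq_trans im' _; apply: mmax; rewrite /Q m'n; exact/asboolP.
  exists (fun n => projT1 (sel n)); split.
    by move=> n; have [] := projT2 (sel n).
  move=> W /=; rewrite nbhsE => -[W' [oW' W'z] W'W].
  have [i Biz iW] := bB _ _ oW' W'z.
  have [N _ NU] := meetU i.+1.
  exists (maxn N i.+1) => // n /=; rewrite geq_max => /andP[Nn im].
  apply/W'W/iW; have [_ /(_ i.+1 im (NU _ Nn))] := projT2 (sel n).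
  by apply; split.
- move=> psi zk z ipsi zkP zkz [i /= npi Biz].
  have [N _ NB] : \forall k \near \oo, B i (zk k).
    by apply: zkz; exact: open_nbhs_nbhs.
  (* By this index [zk] has entered [B i], while the graphs already miss [B i]. *)
  pose k := maxn N i.+1.
  have ik : (i < psi k)%N.
    by rewrite (leq_trans _ (increasing_seq_ge ipsi k))// leq_maxr.
  suff : (graph (u (phi (psi k))) `&` B i) (zk k) by rewrite disj.
  by split; [exact: zkP|apply: NB; rewrite /= leq_maxl].
Qed.

Lemma closed_cc (X : topologicalType) (K : set (crel X)) (u : nat -> crel X)
    (F : crel X) :
  closed K -> (forall n, K (u n)) -> closed_converges u F -> K F.
Proof.
move=> cK uK uF; apply: contrapT => nKF.
have : open (~` K) by exact: closed_openC.
move=> /crel_openE /(_ u F uF nKF) [N _ /(_ N (leqnn N))]; exact.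
Qed.

(** Otherwise some [u m] in [K] escapes the first [m] finite unions of basic sets, for every [m]. A
    subsequence converges to some [F] in [K], and by continuity from below a finite union of basic
    sets missed by [F] has measure above [c]. The subsequence eventually misses this union too,
    which contradicts the choice of [u]. *)
Lemma finite_separating_opens (R : realType) (X : ptopologicalType)
    (B : nat -> set (X * X)) (Bbase : countable_base B)
    (mu : {measure set (borel X * borel X) -> \bar R})
    (Bmeas : forall i, measurable (B i : set (borel X * borel X)))
    (K : set (crel X)) (K_closed : closed K)
    (K0 : forall F, K F -> graph F !=set0) (c : \bar R)
    (Kc : forall F, K F -> (c < mu (~` graph F))%E) :
  exists (A : nat -> set (X * X)) (m : nat),
    forall F, K F -> exists2 j, (j < m)%N &
      [/\ open (A j), (c < mu (A j))%E & A j `<=` ~` graph F].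
Proof.
have [oB _] := Bbase.
(* [A] enumerates all finite unions of basic sets; an index that codes no list gives the empty
   union. *)
pose A j := \bigcup_(i in
  [set i | i \in odflt [::] (choice.unpickle j : option (seq nat))]) B i.
exists A; apply: contrapT => nex.
have /choice [u uP] : forall m, exists F, K F /\ forall j, (j < m)%N ->
    ~ [/\ open (A j), (c < mu (A j))%E & A j `<=` ~` graph F].
  move=> m; apply: contrapT => nF; apply: nex; exists m => F KF.
  apply: contrapT => nj; apply: nF; exists F; split => // j jm jA.
  by apply: nj; exists j.
have u0 n : graph (u n) !=set0 by apply: K0; case: (uP n).
have [phi [F [p [iphi uF Fp disj]]]] := closed_limit Bbase u0.
have KF : K F.
  by apply: closed_cc uF => // n; case: (uP (phi n)).
(* The index in [A] of the union of the missed basic sets numbered below [n]. *)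
pose code n := choice.pickle [seq i <- iota 0 n | `[< p i >]].
have AE n : A (code n) = \bigcup_(i in [set i | (i < n)%N /\ p i]) B i.
  rewrite /A /code choice.pickleK /=; congr (\bigcup_(i in _) _).
  apply/seteqP; split=> i /=; rewrite mem_filter mem_iota add0n leq0n /=.
    by move=> /andP[/asboolP ? ?].
  by move=> [-> ?]; rewrite andbT; apply/asboolP.
have mA n : measurable (A (code n) : set (borel X * borel X)).
  by rewrite AE; apply: bigcup_measurable.
have cvA : mu (A (code n)) @[n --> \oo] --> mu (~` graph F).
  have -> : ~` graph F = \bigcup_n A (code n).
    rewrite Fp; apply/seteqP; split=> z.
      by move=> [i pi Bi]; exists i.+1 => //; rewrite AE; exists i => /=.
    by move=> [n _]; rewrite AE => -[i [_ pi] Bi]; exists i.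
  apply: (nondecreasing_cvg_mu (mu := mu) (F := fun n => A (code n))) => //.
    exact: bigcupT_measurable.
  move=> n m nm; apply/subsetPset; rewrite !AE => z [i [/= iN pi] Bi].
  by exists i => //=; split=> //; apply: leq_trans iN nm.
have [n cn] : exists n, (c < mu (A (code n)))%E.
  have : nbhs (mu (~` graph F)) [set y | (c < y)%E].
    by apply: open_nbhs_nbhs; split; [exact: open_ereal_gt_ereal|exact: Kc].
  by move=> /cvA [n _ /(_ n (leqnn n))]; exists n.
(* Large enough for [u (phi k)] to miss all sets in the union, and for [phi k] to exceed the index
   of the union. *)
pose k := maxn n (code n).+1.
have [_ /(_ (code n))] := uP (phi k); apply.
  by rewrite (leq_trans _ (increasing_seq_ge iphi k))// leq_maxr.
split => //.
  by apply: bigcup_open.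
move=> z; rewrite AE => -[i [/= iN pi] Bi] uz.
suff : (graph (u (phi k)) `&` B i) z by rewrite disj// (leq_trans iN)// leq_maxl.
by split.
Qed.

(** * Weak law of large numbers for pairwise independent events *)

Lemma measurable_le_set (R : realType) (d : measure_display)
    (T : measurableType d) (f g : T -> R) :
  measurable_fun [set: T] f -> measurable_fun [set: T] g ->
  measurable [set w | f w <= g w].
Proof.
move=> mf mg.
have := measurable_fun_ler mf mg measurableT (Y := [set true]) Logic.I.
by rewrite setTI.
Qed.

Section weak_law.
Context (R : realType) (d : measure_display) (T : measurableType d)
  (Pr : probability T R).
Variables (W : nat -> set T) (p : R).
Hypothesis mW : forall k, measurable (W k).
Hypothesis PW : forall k, Pr (W k) = p%:E.
Hypothesis PW2 : forall k l, k <> l -> Pr (W k `&` W l) = (p * p)%:E.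

Definition hits (n : nat) (w : T) : R := \sum_(k < n) \1_(W k) w.

Lemma measurable_hits n : measurable_fun [set: T] (hits n).
Proof. by apply: measurable_sum => k; exact: measurable_indic. Qed.

Lemma hits_ge0 n w : 0 <= hits n w.
Proof. by apply: sumr_ge0 => k _; rewrite indicE. Qed.

Lemma integral_hits n : (\int[Pr]_w (hits n w)%:E = (n%:R * p)%:E)%E.
Proof.
transitivity (\int[Pr]_w (\sum_(k < n) (\1_(W k) w)%:E))%E.
  by apply: eq_integral => w _; rewrite sumEFin.
rewrite ge0_integral_sum//.
- rewrite (eq_bigr (fun _ => p%:E)); last first.
    move=> k _; rewrite integral_indic//= setIT.
    exact: PW.
  by rewrite sumEFin sumr_const card_ord mulr_natl.
- move=> k; apply/measurable_EFinP; exact: measurable_indic.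
Qed.

Lemma hits_sqr n w :
  hits n w ^+ 2 = \sum_(k < n) \sum_(l < n) \1_(W k `&` W l) w.
Proof.
rewrite expr2 /hits mulr_suml; apply: eq_bigr => k _.
by rewrite mulr_sumr; apply: eq_bigr => l _; rewrite indicI.
Qed.

(** The [n] diagonal terms of the double sum contribute [p] each, the [n * (n - 1)] others [p ^+ 2]
    each by pairwise independence. *)
Lemma integral_hits_sqr n : (\int[Pr]_w (hits n w ^+ 2)%:E =
  (n%:R * p + n%:R * (n%:R - 1) * p ^+ 2)%:E)%E.
Proof.
transitivity (\int[Pr]_w
    (\sum_(k < n) \sum_(l < n) (\1_(W k `&` W l) w)%:E))%E.
  apply: eq_integral => w _; rewrite hits_sqr -sumEFin.
  by apply: eq_bigr => k _; rewrite sumEFin.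
have mi k l : measurable_fun [set: T] (fun w => (\1_(W k `&` W l) w)%:E : \bar R).
  by apply/measurable_EFinP; apply: measurable_indic; exact: measurableI.
rewrite ge0_integral_sum//; last 2 first.
- by move=> k; apply: emeasurable_sum => l.
- by move=> k w _; apply: sume_ge0.
have eqk (k : 'I_n) : (\int[Pr]_w (\sum_(l < n) (\1_(W k `&` W l) w)%:E) =
    (p + (n%:R - 1) * p ^+ 2)%:E)%E.
  rewrite ge0_integral_sum//.
  rewrite (bigD1 k)//= integral_indic; [|exact: measurableT|exact: measurableI].
  rewrite setIT setIid [X in (X + _)%E]PW.
  rewrite (eq_bigr (fun _ => (p ^+ 2)%:E)); last first.
    move=> l lk; rewrite integral_indic; [|exact: measurableT|exact: measurableI].
    rewrite setIT expr2; apply: PW2 => kl.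
    by move: lk; rewrite -val_eqE /= kl eqxx.
  rewrite sumEFin sumr_const -EFinD; congr (_ + _)%:E.
  rewrite (eq_card (B := predC1 k))// cardC1 card_ord -[LHS]mulr_natl.
  by case: n k => [[]//|n' _]; rewrite -natr1 addrK.
rewrite (eq_bigr (fun _ => (p + (n%:R - 1) * p ^+ 2)%:E)); last by move=> k _; exact: eqk.
rewrite sumEFin sumr_const card_ord; congr _%:E; rewrite -[LHS]mulr_natl; ring.
Qed.

Lemma hit_probability_itv : 0 <= p <= 1.
Proof.
by rewrite -!lee_fin -(PW 0) measure_ge0 probability_le1.
Qed.

(** The variance is exactly [n * (p - p ^+ 2)]. *)
Lemma hits_variance n :
  (\int[Pr]_w ((hits n w - n%:R * p) ^+ 2)%:E <= n%:R%:E)%E.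
Proof.
have /andP[p0 p1] := hit_probability_itv.
set V := (X in (X <= _)%E); pose a : R := n%:R * p.
have a0 : 0 <= a by rewrite mulr_ge0.
have mS := measurable_hits n.
(* The square is expanded with its cross term moved to the left, so that every integrand is
   nonnegative and integrals add without integrability conditions. *)
have : (V + (2 * a * a)%:E = (n%:R * p + n%:R * (n%:R - 1) * p ^+ 2)%:E + (a ^+ 2)%:E)%E.
  have -> : ((2 * a * a)%:E = \int[Pr]_w ((2 * a)%:E * (hits n w)%:E))%E.
    rewrite ge0_integralZl//= ?integral_hits -?EFinM//.
    - exact/measurable_EFinP.
    - by move=> w _; rewrite lee_fin hits_ge0.
    - by rewrite lee_fin mulr_ge0.
  rewrite -integral_hits_sqr.
  have -> : ((a ^+ 2)%:E = \int[Pr]_w (a ^+ 2)%:E)%E.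
    rewrite integral_cst//= -[LHS]mule1; congr (_ * _)%E.
    exact/esym/probability_setT.
  rewrite /V -!ge0_integralD//.
  - apply: eq_integral => w _; rewrite -!EFinD; congr _%:E.
    rewrite -/a; ring.
  - by move=> w _; rewrite lee_fin sqr_ge0.
  - by apply/measurable_EFinP; exact: measurable_funX.
  - by move=> w _; rewrite lee_fin sqr_ge0.
  - by move=> w _; rewrite lee_fin sqr_ge0.
  - by apply/measurable_EFinP; apply: measurable_funX; apply: measurable_funB.
  - by move=> w _; rewrite -EFinM lee_fin mulr_ge0 ?hits_ge0// mulr_ge0.
  - by apply: measurable_funeM; exact/measurable_EFinP.
rewrite -EFinD => eqV.
have Vle : V = (n%:R * (p - p ^+ 2))%:E.
  rewrite -(addeK V (_ : (2 * a * a)%:E \is a fin_num))// eqV.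
  by rewrite -EFinB; congr _%:E; rewrite /a; ring.
rewrite Vle lee_fin ler_piMr//.
have : 0 <= p ^+ 2 by rewrite sqr_ge0.
lra.
Qed.

(** Chebyshev's inequality: [(n * e) ^+ 2] times the indicator of the event is at most the squared
    deviation. *)
Lemma weak_law_bound n (e : R) : (0 < n)%N -> 0 < e ->
  (Pr [set w | n%:R * e <= `|hits n w - n%:R * p|]%R <= ((n%:R * e ^+ 2)^-1)%:E)%E.
Proof.
move=> n0 e0; set B := [set w | _].
have n0R : 0 < n%:R :> R by rewrite ltr0n.
have mB : measurable B.
  apply: measurable_le_set => //; apply: measurableT_comp => //.
  by apply: measurable_funB => //; exact: measurable_hits.
have : (((n%:R * e) ^+ 2)%:E * Pr B <= n%:R%:E)%E.
  apply: le_trans (hits_variance n).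
  rewrite -(setIT B) -integral_indic// -ge0_integralZl//; first last.
  - by rewrite lee_fin sqr_ge0.
  - by apply/measurable_EFinP; exact: measurable_indic.
  apply: ge0_le_integral => //.
  - by move=> w _; rewrite -EFinM lee_fin mulr_ge0 ?sqr_ge0.
  - by apply: measurable_funeM; apply/measurable_EFinP; exact: measurable_indic.
  - apply/measurable_EFinP; apply: measurable_funX; apply: measurable_funB => //.
    exact: measurable_hits.
  - move=> w _; rewrite -EFinM lee_fin indicE.
    have [/set_mem wB|_] := boolP (w \in B); last by rewrite mulr0 sqr_ge0.
    rewrite mulr1 -[leRHS]real_normK ?num_real//.
    by rewrite lerXn2r ?nnegrE// mulr_ge0// ltW.
rewrite -lee_pdivlMl ?exprn_gt0 ?mulr_gt0// => /le_trans; apply.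
rewrite -EFinM lee_fin exprMn expr2 -mulrA invfM mulrAC.
by rewrite mulVf ?gt_eqF// mul1r.
Qed.

Lemma weak_law (e : R) : 0 < e ->
  Pr [set w | n%:R * e <= `|hits n w - n%:R * p|] @[n --> \oo] --> 0%E.
Proof.
move=> e0.
apply: (@squeeze_cvge _ _ _ _ (cst 0%E) _ (fun n => ((n%:R * e ^+ 2)^-1)%:E)).
- near=> n; apply/andP; split; first exact: measure_ge0.
  by apply: weak_law_bound => //; near: n; exact: nbhs_infty_gt.
- exact: cvg_cst.
- apply: cvg_EFin; first by near=> n.
  have -> : fine \o (fun n : nat => ((n%:R * e ^+ 2)^-1)%:E) =
      (fun n : nat => (n%:R)^-1 * (e ^+ 2)^-1).
    by apply/funext => n /=; rewrite invfM.
  rewrite -[0](mul0r ((e ^+ 2)^-1)); apply: cvgMr_tmp.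
  apply/gtr0_cvgV0; last exact: cvgr_idn.
  by near=> n; rewrite ltr0n; near: n; exact: nbhs_infty_gt.
Unshelve. all: by end_near. Qed.

End weak_law.

(** * The law of the observed choices *)

Definition to_mfun d1 d2 (T1 : measurableType d1) (T2 : measurableType d2)
    (f : T1 -> T2) (mf : measurable_fun [set: T1] f) : {mfun T1 >-> T2} :=
  HB.pack_for {mfun T1 >-> T2} f (isMeasurableFun.Build _ _ _ _ f mf).

Section independence.
Context (R : realType) (d : measure_display) (Omega : measurableType d)
  (Pr : probability Omega R).

Lemma measurable_preimageT d1 (T1 : measurableType d1) (f : Omega -> T1)
    (A : set T1) :
  measurable_fun [set: Omega] f -> measurable A -> measurable (f @^-1` A).
Proof. by move=> mf mA; rewrite -[X in measurable X]setTI; exact: mf. Qed.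

(** As functions of [C], both sides are finite measures: the law of [f] under [Pr] restricted to
    [E], and the law of [f] scaled by [Pr E]. They agree on rectangles, which are stable under
    intersection and generate the product sigma-algebra. *)
Lemma rectangle_independence d1 d2 (T1 : measurableType d1)
    (T2 : measurableType d2) (f : Omega -> T1 * T2) (E : set Omega) :
  measurable_fun [set: Omega] f -> measurable E ->
  (forall A B, measurable A -> measurable B ->
    Pr (E `&` f @^-1` (A `*` B)) = (Pr E * Pr (f @^-1` (A `*` B)))%E) ->
  forall C, measurable C -> Pr (E `&` f @^-1` C) = (Pr E * Pr (f @^-1` C))%E.
Proof.
move=> mf mE rect C mC.
pose fm := to_mfun mf.
have PE0 : 0 <= fine (Pr E) by rewrite fine_ge0.
pose m1 : {measure set (T1 * T2) -> \bar R} :=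
  mscale (NngNum PE0) (distribution Pr fm).
pose m2_ : {measure set (T1 * T2) -> \bar R} :=
  pushforward (mrestr Pr mE) fm.
pose m2 := m2_ mf.
have m1E A : m1 A = (Pr E * Pr (f @^-1` A))%E.
  have -> : Pr E = (fine (Pr E))%:E by rewrite fineK// fin_num_measure.
  by [].
have m2E A : m2 A = Pr (E `&` f @^-1` A) by rewrite setIC.
rewrite -m1E -m2E; apply/esym.
apply: (measure_unique
  [set A `*` B | A in @measurable _ T1 & B in @measurable _ T2] (fun=> setT)) => //.
- exact: measurable_prod_measurableType.
- move=> _ _ [A1 mA1 [B1 mB1 <-]] [A2 mA2 [B2 mB2 <-]].
  rewrite -setXI; exists (A1 `&` A2); first exact: measurableI.
  by exists (B1 `&` B2) => //; exact: measurableI.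
- by move=> _; exists setT => //; exists setT => //; rewrite setXTT.
- by apply/seteqP; split=> // z _; exists 0%N.
- by move=> _ [A mA [B mB <-]]; rewrite m1E m2E rect.
- move=> _; rewrite m1E -ge0_fin_numE ?mule_ge0//.
  by rewrite fin_numM// fin_num_measure// preimage_setT.
Qed.

Lemma independent_family_seq d' (T : measurableType d') (I : choiceType)
    (Z : I -> Omega -> T) (s : seq I) (A : I -> set T) :
  mutually_independent Pr Z -> uniq s -> (forall i, measurable (A i)) ->
  Pr [set w | forall i, i \in s -> A i (Z i w)] =
  (\prod_(i <- s) Pr (Z i @^-1` A i))%E.
Proof.
move=> indep us mA.
transitivity (\prod_(i <- [fset x in s]%fset) Pr (Z i @^-1` A i))%E.
  rewrite -indep//; congr (Pr _); apply/seteqP; split=> w /= wA i.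
    by rewrite /= in_fset => /wA.
  by move=> si; apply: wA; rewrite /= in_fset.
apply: perm_big; apply: uniq_perm => // i; by rewrite in_fset.
Qed.

(** The joint law of [f] and [g] agrees with the product measure on rectangles, hence everywhere,
    and Tonelli's theorem factors the integral. *)
Lemma independent_integralM d1 d2 (T1 : measurableType d1)
    (T2 : measurableType d2) (mu : {sigma_finite_measure set T1 -> \bar R})
    (nu : {sigma_finite_measure set T2 -> \bar R})
    (f : Omega -> T1) (g : Omega -> T2) (G : T1 -> \bar R) (H : T2 -> \bar R) :
  measurable_fun [set: Omega] f -> measurable_fun [set: Omega] g ->
  (forall B C, measurable B -> measurable C ->
    Pr (f @^-1` B `&` g @^-1` C) = (mu B * nu C)%E) ->
  measurable_fun [set: T1] G -> measurable_fun [set: T2] H ->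
  (forall z, 0 <= G z)%E -> (forall z, 0 <= H z)%E ->
  (\int[Pr]_w (G (f w) * H (g w)) = \int[mu]_z G z * \int[nu]_z H z)%E.
Proof.
move=> mf mg fg mG mH G0 H0.
have mfg : measurable_fun [set: Omega] (fun w => (f w, g w)).
  exact: measurable_fun_pair.
pose fm := to_mfun mfg.
pose GH (z : T1 * T2) : \bar R := (G z.1 * H z.2)%E.
have mGH : measurable_fun [set: T1 * T2] GH.
  apply: emeasurable_funM.
    exact: measurableT_comp mG measurable_fst.
  exact: measurableT_comp mH measurable_snd.
have GH0 z : (0 <= GH z)%E by rewrite mule_ge0.
transitivity (\int[distribution Pr fm]_z GH z)%E.
  by rewrite ge0_integral_distribution.
transitivity (\int[mu \x nu]_z GH z)%E.
  apply: eq_measure_integral => A mA _; apply/esym.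
  by apply: product_measure_unique => // B C mB mC; rewrite -fg.
rewrite fubini_tonelli1//.
transitivity (\int[mu]_z (G z * \int[nu]_z' H z'))%E.
  apply: eq_integral => z _; rewrite /fubini_F /GH /=.
  by rewrite ge0_integralZl.
rewrite ge0_integralZr//; exact: integral_ge0.
Qed.

End independence.

(** * Joint laws of the draws and independence of the problems *)

Section draws.
Context (R : realType) (X : ptopologicalType) (lambda : probability (borel X) R)
  (d : measure_display) (Omega : measurableType d) (Pr : probability Omega R).
Variables (x y : nat -> {RV Pr >-> borel X}).
Hypothesis xy_iid : iid (draws x y) lambda.

Local Notation XX := (borel X * borel X)%type.
Local Notation lambda2 := (lambda \x lambda)%E.

Let measurable_draw i : measurable_fun [set: Omega] (draws x y i : Omega -> borel X).
Proof. by case: i => k /=; exact: measurable_funP. Qed.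

(** Independence gives the product formula on rectangles, which determines the law. Any two distinct
    draws are allowed, not only those of one problem, because ties across problems must be excluded
    as well. *)
Lemma pair_law (i j : nat + nat) (C : set XX) : i != j -> measurable C ->
  Pr [set w | C (draws x y i w, draws x y j w)] = lambda2 C.
Proof.
move=> ij mC; have [indep law] := xy_iid.
have mf : measurable_fun [set: Omega]
    (fun w => (draws x y i w, draws x y j w) : XX).
  exact: measurable_fun_pair.
pose fm := to_mfun mf.
rewrite (product_measure_unique (m1 := lambda) (m2 := lambda)
  (m' := distribution Pr fm))// => A B mA mB.
pose S k := if k == i then A else B.
have := independent_family_seq (s := [:: i; j]) (A := S) indep.
rewrite /= inE ij => /(_ isT) mP.
have {}mP := mP (fun k => ltac:(rewrite /S; case: ifP => _; assumption)).
transitivity (Pr [set w | forall k, k \in [:: i; j] -> S k (draws x y k w)]).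
  congr (Pr _); apply/seteqP; split=> w /=.
    move=> [wA wB] k; rewrite !inE /S => /orP[]/eqP->; rewrite ?eqxx//.
    by rewrite eq_sym (negbTE ij).
  move=> wS; split.
    by have := wS i; rewrite inE eqxx /S eqxx; exact.
  have := wS j; rewrite !inE eqxx orbT /S eq_sym (negbTE ij); exact.
rewrite mP !big_cons big_nil mule1 /S eqxx eq_sym (negbTE ij).
by congr (_ * _)%E; exact: law.
Qed.

Definition problem (k : nat) (w : Omega) : XX := (x k w, y k w).

Lemma measurable_problem k : measurable_fun [set: Omega] (problem k).
Proof. exact: measurable_fun_pair. Qed.

(** This is [lambda2], obtained as the law of problem 0 so that it is a probability by
    construction. *)
Definition problem_law : probability XX R :=
  distribution Pr (to_mfun (measurable_problem 0)).

Lemma problem_lawE (C : set XX) : measurable C -> problem_law C = lambda2 C.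
Proof. by move=> mC; rewrite -(@pair_law (inl 0%N) (inr 0%N)). Qed.

Lemma distribution_problem k (C : set XX) : measurable C ->
  Pr (problem k @^-1` C) = problem_law C.
Proof. by move=> mC; rewrite problem_lawE// -(@pair_law (inl k) (inr k)). Qed.

(** Two different problems involve four distinct draws, each constrained by its own set. *)
Lemma four_independent (k l : nat) (A1 A2 A3 A4 : set (borel X)) : k <> l ->
  measurable A1 -> measurable A2 -> measurable A3 -> measurable A4 ->
  Pr (problem k @^-1` (A1 `*` A2) `&` problem l @^-1` (A3 `*` A4)) =
  (Pr (problem k @^-1` (A1 `*` A2)) * Pr (problem l @^-1` (A3 `*` A4)))%E.
Proof.
move=> /eqP kl mA1 mA2 mA3 mA4; have [indep law] := xy_iid.
rewrite !distribution_problem ?problem_lawE; [|exact: measurableX..].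
rewrite !product_measure1E//.
pose S (i : nat + nat) := if i == inl k then A1 else if i == inr k then A2
  else if i == inl l then A3 else A4.
have lk : (l == k) = false by rewrite eq_sym (negbTE kl).
have e1 (a b : nat) : ((inl a : nat + nat) == inl b) = (a == b) by [].
have e2 (a b : nat) : ((inr a : nat + nat) == inr b) = (a == b) by [].
have e3 (a b : nat) : ((inl a : nat + nat) == inr b) = false by [].
have e4 (a b : nat) : ((inr a : nat + nat) == inl b) = false by [].
have Sk : S (inl k) = A1 by rewrite /S eqxx.
have Sk' : S (inr k) = A2 by rewrite /S e4 eqxx.
have Sl : S (inl l) = A3 by rewrite /S e1 e3 lk eqxx.
have Sl' : S (inr l) = A4 by rewrite /S !e4 e2 lk.
have := independent_family_seq (s := [:: inl k; inr k; inl l; inr l]) (A := S)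
  indep.
have -> : uniq [:: inl k; inr k; inl l; inr l : nat + nat].
  by rewrite /= !inE !(e1, e2, e3, e4) (negbTE kl).
move=> /(_ isT) mP.
have {}mP : Pr _ = _ :=
  mP (fun i => ltac:(rewrite /S; repeat case: ifP => _; assumption)).
rewrite !big_cons big_nil mule1 Sk Sk' Sl Sl' in mP.
rewrite -muleA; apply: etrans (etrans mP _); last first.
  by do 3?[congr (_ * _)%E]; exact: law.
congr (Pr _); apply/seteqP; split=> w /=.
  move=> [[/= w1 w2] [/= w3 w4]] i.
  by rewrite !inE => /or4P[]/eqP->; rewrite ?(Sk, Sk', Sl, Sl').
move=> wS; split; split=> /=.
- by have := wS (inl k); rewrite Sk; apply; rewrite !inE eqxx.
- by have := wS (inr k); rewrite Sk'; apply; rewrite !inE eqxx !orbT.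
- by have := wS (inl l); rewrite Sl; apply; rewrite !inE eqxx !orbT.
- by have := wS (inr l); rewrite Sl'; apply; rewrite !inE eqxx !orbT.
Qed.

(** Rectangles are extended to measurable sets one problem at a time: first for [l] with the event
    of [k] fixed, then for [k] with a rectangle of [l] fixed. *)
Lemma problems_independent (k l : nat) (B C : set XX) : k <> l ->
  measurable B -> measurable C ->
  Pr (problem k @^-1` B `&` problem l @^-1` C) = (problem_law B * problem_law C)%E.
Proof.
move=> kl mB mC.
have mk (D : set XX) i : measurable D -> measurable (problem i @^-1` D).
  by move=> mD; apply: measurable_preimageT mD; exact: measurable_problem.
rewrite -(distribution_problem k)// -(distribution_problem l)//.
apply: rectangle_independence => //; [exact: measurable_problem|exact: mk|].
move=> A3 A4 mA3 mA4; rewrite setIC muleC.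
have mX34 := measurableX mA3 mA4.
apply: rectangle_independence => //; [exact: measurable_problem|exact: mk|].
move=> A1 A2 mA1 mA2; rewrite setIC muleC.
exact: four_independent.
Qed.

Lemma integral_problem k (G : XX -> \bar R) : measurable_fun [set: XX] G ->
  (forall z, 0 <= G z)%E ->
  (\int[Pr]_w G (problem k w) = \int[problem_law]_z G z)%E.
Proof.
move=> mG G0.
transitivity (\int[pushforward Pr (problem k)]_z G z)%E.
  rewrite ge0_integral_pushforward//; exact: measurable_problem.
pose fm := to_mfun (measurable_problem k).
rewrite -[LHS]/(\int[distribution Pr fm]_z G z)%E.
apply: eq_measure_integral => A mA _; exact: distribution_problem.
Qed.

Lemma integral_problems k l (G H : XX -> \bar R) : k <> l ->
  measurable_fun [set: XX] G -> measurable_fun [set: XX] H ->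
  (forall z, 0 <= G z)%E -> (forall z, 0 <= H z)%E ->
  (\int[Pr]_w (G (problem k w) * H (problem l w)) =
   \int[problem_law]_z G z * \int[problem_law]_z H z)%E.
Proof.
move=> kl mG mH G0 H0.
apply: independent_integralM => //; [exact: measurable_problem..|].
by move=> B C mB mC; exact: problems_independent.
Qed.

(** * Law and independence of the (chosen, rejected) pairs *)

Section choices.
Variables (c : nat -> {RV Pr >-> bool}) (p : X -> X -> R).
Hypothesis mp : measurable_fun [set: XX] (fun z => p z.1 z.2).
Hypothesis p01 : forall u v, 0 <= p u v <= 1.
Hypothesis c_drawn : choices_drawn x y c p.

(** The conditional probability, given the problem [z], that the choice matches [o]; [None] puts no
    constraint on the choice. *)
Definition pattern_weight (o : option bool) (z : XX) : R :=
  match o with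
  | Some true => p z.1 z.2
  | Some false => 1 - p z.1 z.2
  | None => 1
  end.

Definition matches (o : option bool) (b : bool) : Prop :=
  if o is Some b' then b = b' else True.

Lemma pattern_weight_ge0 o z : 0 <= pattern_weight o z.
Proof.
by case: o => [[]|] //=; have /andP[] := p01 z.1 z.2; rewrite ?subr_ge0.
Qed.

Lemma measurable_pattern_weight o : measurable_fun [set: XX] (pattern_weight o).
Proof.
case: o => [[]|]; [exact: mp| |exact: measurable_cst].
rewrite [X in measurable_fun _ X](_ : _ = cst 1 \- (fun z : XX => p z.1 z.2))//.
exact: measurable_funB.
Qed.

Let measurable_pattern n (s : nat -> option bool) :
  measurable [set w | forall k, (k < n)%N -> matches (s k) (c k w)].
Proof.
rewrite [X in measurable X](_ : _ =
    \bigcap_(k in `I_n) (c k @^-1` [set b | matches (s k) b])).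
  by apply: bigcap_measurableType => k _; exact: measurable_preimageT.
by apply/seteqP; split.
Qed.

Let sigma_draws_measurable E : sigma_draws x y E -> measurable E.
Proof.
apply: smallest_sub; first exact: sigma_algebra_measurable.
move=> _ [i _ [A mA <-]]; exact: measurable_draw.
Qed.

(** [choices_drawn] prescribes all of the first [n] choices, whereas only one or two are of interest
    below. A free choice is summed out because its two weights add up to 1. *)
Lemma choices_pattern n (s : nat -> option bool) (E : set Omega) :
  sigma_draws x y E ->
  Pr (E `&` [set w | forall k, (k < n)%N -> matches (s k) (c k w)]) =
  (\int[Pr]_(w in E) (\prod_(k < n) pattern_weight (s k) (problem k w))%:E)%E.
Proof.
move=> sE; have mE := sigma_draws_measurable sE.
(* The induction is on a bound [m] from which on every choice is constrained. Positions from [n] on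
   do not affect the event, so filling them makes [n] such a bound. *)
pose s' m k := if (m <= k)%N && (s k == None) then Some true else s k.
suff H m t : (forall k, (m <= k)%N -> t k <> None) ->
    Pr (E `&` [set w | forall k, (k < n)%N -> matches (t k) (c k w)]) =
    (\int[Pr]_(w in E) (\prod_(k < n) pattern_weight (t k) (problem k w))%:E)%E.
  have -> : (\int[Pr]_(w in E)
      (\prod_(k < n) pattern_weight (s k) (problem k w))%:E)%E =
      (\int[Pr]_(w in E)
      (\prod_(k < n) pattern_weight (s' n k) (problem k w))%:E)%E.
    apply: eq_integral => w _; congr _%:E; apply: eq_bigr => k _.
    by rewrite /s' leqNgt ltn_ord.
  rewrite -(H n); last by move=> k nk; rewrite /s' nk /=; case: (s k).
  congr (Pr (E `&` _)); apply/seteqP; split=> w /= wk k kn; have := wk k kn;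
    by rewrite /s' leqNgt kn.
(* Sum out the unconstrained choices one at a time. *)
elim: m t => [t tN|m IH t tN].
  pose b k := odflt true (t k).
  have tb k : t k = Some (b k) by rewrite /b; case: (t k) (tN k isT).
  have := c_drawn n b sE.
  have -> : [set w | forall k, (k < n)%N -> c k w = b k] =
      [set w | forall k, (k < n)%N -> matches (t k) (c k w)].
    by apply/seteqP; split=> w /= wk k kn; have := wk k kn; rewrite tb.
  move=> ->; apply: eq_integral => w _; congr _%:E; apply: eq_bigr => k _.
  by rewrite tb; case: (b k).
case tm : (t m) => [b|].
  apply: IH => k; rewrite leq_eqVlt => /predU1P[<-|]; last exact: tN.
  by rewrite tm.
pose tt b k := if k == m then Some b else t k.
have ttN b k : (m <= k)%N -> tt b k <> None.
  rewrite leq_eqVlt /tt eq_sym; case: eqP => //= _; exact: tN.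
(* A free position outside the first [n] can be filled arbitrarily; one inside splits the event
   according to the choice made there. *)
have [nm|mn] := leqP n m.
  have ttE k : (k < n)%N -> tt true k = t k.
    by move=> kn; rewrite /tt; case: eqP => // km; move: nm; rewrite leqNgt -km kn.
  have := IH _ (ttN true).
  rewrite [X in Pr (_ `&` X)](_ : _ =
      [set w | forall k, (k < n)%N -> matches (t k) (c k w)]); last first.
    by apply/seteqP; split=> w /= wk k kn; have := wk k kn; rewrite ttE.
  move=> ->; apply: eq_integral => w _; congr _%:E; apply: eq_bigr => k _.
  by rewrite ttE.
have split_set : E `&` [set w | forall k, (k < n)%N -> matches (t k) (c k w)] =
    (E `&` [set w | forall k, (k < n)%N -> matches (tt true k) (c k w)]) `|`
    (E `&` [set w | forall k, (k < n)%N -> matches (tt false k) (c k w)]).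
  rewrite -setIUr; congr (_ `&` _); apply/seteqP; split=> w /=.
    move=> wk; case cm : (c m w); [left|right] => k kn;
      by rewrite /tt; case: eqP => [->//|_]; exact: wk.
  by move=> [] wk k kn; have := wk k kn; rewrite /tt;
    case: eqP => [->|//]; rewrite tm.
rewrite split_set measureU; first last.
- apply/seteqP; split=> // w /= [[_ wt] [_ wf]].
  by have := wt m mn; have := wf m mn; rewrite /tt eqxx /= => ->.
- exact: measurableI.
- exact: measurableI.
rewrite [X in (X + _)%E](IH _ (ttN true)) [X in (_ + X)%E](IH _ (ttN false)).
have mw (t' : nat -> option bool) : measurable_fun E
    (fun w => (\prod_(k < n) pattern_weight (t' k) (problem k w))%:E : \bar R).
  apply/measurable_EFinP; apply: measurable_funTS.
  apply: measurable_prod => k _.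
  exact: measurableT_comp (measurable_pattern_weight _) (measurable_problem _).
rewrite -ge0_integralD//; first last.
- by move=> w _; rewrite lee_fin prodr_ge0// => k _; exact: pattern_weight_ge0.
- by move=> w _; rewrite lee_fin prodr_ge0// => k _; exact: pattern_weight_ge0.
apply: eq_integral => w _; rewrite -EFinD; congr _%:E.
have prodE t' : (forall k, k != m -> t' k = t k) ->
    \prod_(k < n) pattern_weight (t' k) (problem k w) =
    pattern_weight (t' m) (problem m w) *
    \prod_(k < n | k != Ordinal mn) pattern_weight (t k) (problem k w).
  move=> t'E; rewrite (bigD1 (Ordinal mn))//=; congr (_ * _).
  by apply: eq_bigr => k km; rewrite t'E.
rewrite (prodE t)// tm !prodE.
- by rewrite /tt !eqxx /=; ring.
- by move=> k; rewrite /tt => /negbTE->.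
- by move=> k; rewrite /tt => /negbTE->.
Qed.

(** Over the sigma-algebra generated by the draws each draw is measurable by construction, hence so
    is a pair of draws. *)
Lemma sigma_draws_problem k (C : set XX) : measurable C ->
  sigma_draws x y (problem k @^-1` C).
Proof.
move=> mC.
pose G := \bigcup_i preimage_set_system setT (draws x y i : Omega -> borel X)
  measurable.
have md i : measurable_fun [set: g_sigma_algebraType G]
    (draws x y i : g_sigma_algebraType G -> borel X).
  move=> _ A mA; apply: sub_sigma_algebra; exists i => //; by exists A.
have mpr : measurable_fun [set: g_sigma_algebraType G]
    (problem k : g_sigma_algebraType G -> XX).
  exact: measurable_fun_pair (md (inl k)) (md (inr k)).
by have := mpr measurableT C mC; rewrite setTI.
Qed.

Lemma sigma_drawsI E F : sigma_draws x y E -> sigma_draws x y F ->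
  sigma_draws x y (E `&` F).
Proof.
pose G := \bigcup_i preimage_set_system setT (draws x y i : Omega -> borel X)
  measurable.
exact: (@measurableI _ (g_sigma_algebraType G)).
Qed.

Definition chosen (k : nat) (w : Omega) : XX :=
  if c k w then (x k w, y k w) else (y k w, x k w).

(** When the choice is [b], the chosen pair lies in [A] exactly if the problem lies in
    [flip b A]. *)
Definition flip (b : bool) (A : set XX) : set XX :=
  if b then A else [set z | A (z.2, z.1)].

(** The conditional probability, given the problem [z], that the choice is [b] and the chosen pair
    lies in [A]. *)
Definition flip_weight (A : set XX) (b : bool) (z : XX) : \bar R :=
  (\1_(flip b A) z * pattern_weight (Some b) z)%:E.

Lemma measurable_flip b A : measurable A -> measurable (flip b A).
Proof.
case: b => //= mA.
have : measurable_fun [set: XX] (fun z : XX => (z.2, z.1)).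
  exact: measurable_fun_pair.
by move=> /(_ measurableT A mA); rewrite setTI.
Qed.

Lemma flip_weight_ge0 A b z : (0 <= flip_weight A b z)%E.
Proof. by rewrite lee_fin mulr_ge0 ?pattern_weight_ge0. Qed.

Lemma measurable_flip_weight A b : measurable A ->
  measurable_fun [set: XX] (flip_weight A b).
Proof.
move=> mA; apply/measurable_EFinP; apply: measurable_funM.
  by apply: measurable_indic; exact: measurable_flip.
exact: measurable_pattern_weight.
Qed.

(** The law of the (chosen, rejected) pair on measurable sets, see [distribution_chosen]; this form
    allows two sets to be compared problem by problem. *)
Definition choice_law (A : set XX) : \bar R :=
  (\int[problem_law]_z (flip_weight A true z + flip_weight A false z))%E.

Lemma choice_lawE A : measurable A -> choice_law A =
  (\int[problem_law]_z flip_weight A true z +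
   \int[problem_law]_z flip_weight A false z)%E.
Proof.
move=> mA; rewrite /choice_law ge0_integralD//.
- by move=> z _; exact: flip_weight_ge0.
- exact: measurable_flip_weight.
- by move=> z _; exact: flip_weight_ge0.
- exact: measurable_flip_weight.
Qed.

Let measurable_choice k b : measurable [set w | c k w = b].
Proof. exact: (measurable_preimageT (f := c k) (A := [set b])). Qed.

Let split_choice k A : Pr A =
  (Pr (A `&` [set w | c k w = true]) + Pr (A `&` [set w | c k w = false]))%E \/
  ~ measurable A.
Proof.
have [mA|] := pselect (measurable A); [left|by right].
rewrite -measureU; first last.
- by apply/seteqP; split=> // w /= [[_ ->] []].
- exact: measurableI.
- exact: measurableI.
congr (Pr _); rewrite -setIUr; apply/seteqP; split=> [w wA|w []//].
by split=> //=; case: (c k w); [left|right].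
Qed.

Lemma measurable_chosen k : measurable_fun [set: Omega] (chosen k).
Proof.
apply: measurable_fun_ifT.
- exact: measurable_funP.
- exact: measurable_fun_pair.
- exact: measurable_fun_pair.
Qed.

(** For each value [b] of the choice, the event constrains the draws of problem [k] by [flip b A]
    and the [k]-th choice alone. *)
Lemma distribution_chosen k A : measurable A ->
  Pr (chosen k @^-1` A) = choice_law A.
Proof.
move=> mA; rewrite choice_lawE//.
have mW := measurable_preimageT (measurable_chosen k) mA.
have [->|//] := split_choice k (chosen k @^-1` A).
suff H b : Pr (chosen k @^-1` A `&` [set w | c k w = b]) =
    (\int[problem_law]_z flip_weight A b z)%E by rewrite !H.
have mf := measurable_flip b mA.
pose s i := if i == k then Some b else None.
transitivity (Pr (problem k @^-1` flip b A `&`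
    [set w | forall i, (i < k.+1)%N -> matches (s i) (c i w)])).
  congr (Pr _); apply/seteqP; split=> w [wA wk]; split.
  - by move: wA wk => /=; rewrite /chosen => + ck; rewrite ck; case: (b).
  - by move=> i _; rewrite /s; case: eqP => // ->.
  - have := wk k (leqnn _); rewrite /s eqxx /= => ck.
    by move: wA; rewrite /= /chosen ck; case: (b).
  - by have := wk k (leqnn _); rewrite /s eqxx.
rewrite choices_pattern; last exact: sigma_draws_problem.
rewrite integral_mkcond.
transitivity (\int[Pr]_w flip_weight A b (problem k w))%E.
  apply: eq_integral => w _; rewrite patchE /flip_weight indicE.
  have -> : (w \in problem k @^-1` flip b A) = (problem k w \in flip b A).
    by apply/idP/idP; rewrite !inE.
  case: ifP => _; last by rewrite mul0r.
  rewrite mul1r big_ord_recr /= big1 ?mul1r /s ?eqxx// => i _.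
  by rewrite ltn_eqF// ltn_ord.
apply: integral_problem; first exact: measurable_flip_weight.
by move=> z; exact: flip_weight_ge0.
Qed.

(** For each of the four pairs of choices the conditional weights multiply, and the integral factors
    since the problems are independent. The four products add up to the product of the two sums. *)
Lemma chosen_independent k l A : k <> l -> measurable A ->
  Pr (chosen k @^-1` A `&` chosen l @^-1` A) = (choice_law A * choice_law A)%E.
Proof.
move=> kl mA.
have mW i := measurable_preimageT (measurable_chosen i) mA.
have mWW : measurable (chosen k @^-1` A `&` chosen l @^-1` A) by exact: measurableI.
suff H b b' : Pr (chosen k @^-1` A `&` chosen l @^-1` A `&`
      [set w | c k w = b] `&` [set w | c l w = b']) =
    (\int[problem_law]_z flip_weight A b z *
     \int[problem_law]_z flip_weight A b' z)%E.
  have [->|//] := split_choice k (chosen k @^-1` A `&` chosen l @^-1` A).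
  have [->|[]] := split_choice l (chosen k @^-1` A `&` chosen l @^-1` A `&`
      [set w | c k w = true]); last exact: measurableI.
  have [->|[]] := split_choice l (chosen k @^-1` A `&` chosen l @^-1` A `&`
      [set w | c k w = false]); last exact: measurableI.
  have I0 b : (0 <= \int[problem_law]_z flip_weight A b z)%E.
    by apply: integral_ge0 => z _; exact: flip_weight_ge0.
  have sqD (a b : \bar R) : (0 <= a -> 0 <= b ->
      a * a + a * b + (b * a + b * b) = (a + b) * (a + b))%E.
    by move=> a0 b0; rewrite ge0_muleDl// !ge0_muleDr.
  by rewrite !H choice_lawE//; exact: sqD.
have mf := measurable_flip b mA; have mf' := measurable_flip b' mA.
pose n := (maxn k l).+1.
have kn : (k < n)%N by rewrite ltnS leq_maxl.
have ln : (l < n)%N by rewrite ltnS leq_maxr.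
have lk : (l == k) = false by apply/eqP => /esym.
pose s i := if i == k then Some b else if i == l then Some b' else None.
have sk : s k = Some b by rewrite /s eqxx.
have sl : s l = Some b' by rewrite /s lk eqxx.
transitivity (Pr ((problem k @^-1` flip b A `&` problem l @^-1` flip b' A) `&`
    [set w | forall i, (i < n)%N -> matches (s i) (c i w)])).
  congr (Pr _); apply/seteqP; split=> w.
    move=> [[[/= wA wA'] ck] cl]; split; last first.
      move=> i _; rewrite /s; case: eqP => [->//|_].
      by case: eqP => [->|].
    move: wA wA'; rewrite /chosen ck cl.
    by split; [case: (b) wA|case: (b') wA'].
  move=> [[/= wA wA'] wn].
  have := wn k kn; rewrite sk /= => ck.
  have := wn l ln; rewrite sl /= => cl.
  split=> //; split=> //; split; rewrite /chosen ?ck ?cl.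
    by case: (b) wA.
  by case: (b') wA'.
rewrite choices_pattern; last first.
  by apply: sigma_drawsI; exact: sigma_draws_problem.
rewrite integral_mkcond.
transitivity (\int[Pr]_w (flip_weight A b (problem k w) *
    flip_weight A b' (problem l w)))%E.
  apply: eq_integral => w _; rewrite patchE /flip_weight !indicE -EFinM.
  rewrite in_setI.
  have E' i B : (w \in problem i @^-1` B) = (problem i w \in B).
    by apply/idP/idP; rewrite !inE.
  rewrite !E'.
  case: ifP => [/andP[-> ->]|/negbT]; last first.
    by rewrite negb_and => /orP[] /negbTE->; rewrite !(mul0r, mulr0).
  rewrite !mul1r (bigD1 (Ordinal kn))//= sk (bigD1 (Ordinal ln))/=; last first.
    by rewrite -val_eqE /= lk.
  rewrite sl big1 ?mulr1// => i /andP[]; rewrite -!val_eqE /= => ik il.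
  by rewrite /s (negbTE ik) (negbTE il).
apply: integral_problems => //; try exact: measurable_flip_weight.
- by move=> z; exact: flip_weight_ge0.
- by move=> z; exact: flip_weight_ge0.
Qed.

End choices.

End draws.

(** * Identification of the preference *)

Lemma crel_eq (X : topologicalType) (F G : crel X) : graph F = graph G -> F = G.
Proof.
case: F G => [f cf] [g cg] /= fg; move: cf cg; rewrite fg => cf cg.
by rewrite (Prop_irrelevance cf cg).
Qed.

(** An open set is a countable union of basic rectangles, so it belongs to the product
    sigma-algebra. *)
Lemma open_product_measurable (X : ptopologicalType) (B : nat -> set X)
    (A : set (X * X)) :
  countable_base B -> open A -> measurable (A : set (borel X * borel X)).
Proof.
move=> Bbase oA; have [f [oF fP]] := prod_countable_base Bbase Bbase.
have -> : A = \bigcup_(i in [set i | B (f i).1 `*` B (f i).2 `<=` A])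
    (B (f i).1 `*` B (f i).2).
  apply/seteqP; split=> z; last by move=> [i iA /iA].
  by move=> Az; have [i iz iA] := fP _ _ oA Az; exists i.
have [oB _] := Bbase.
by apply: bigcup_measurable => i _; apply: measurableX; exact: sub_sigma_algebra.
Qed.

Lemma open_swap (X : topologicalType) (A : set (X * X)) :
  open A -> open [set z | A (z.2, z.1)].
Proof.
move=> oA; have /continuousP := @swap_continuous X X.
by move=> /(_ A oA).
Qed.

Lemma product_open_gt0 (R : realType) (X : ptopologicalType)
    (B : nat -> set X) (Bbase : countable_base B)
    (lambda : probability (borel X) R) (A : set (X * X)) :
  full_support lambda -> open A -> A !=set0 ->
  (0 < (lambda \x lambda) (A : set (borel X * borel X)))%E.
Proof.
move=> supp oA [z Az]; have [f [oF fP]] := prod_countable_base Bbase Bbase.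
have [i iz iA] := fP _ _ oA Az; have [oB _] := Bbase.
have mB j : measurable (B j : set (borel X)) by exact: sub_sigma_algebra.
have : (0 < (lambda \x lambda) (B (f i).1 `*` B (f i).2 : set (borel X * borel X)))%E.
  rewrite product_measure1E// mule_gt0// supp//; first by exists z.1; case: iz.
  by exists z.2; case: iz.
move=> /lt_le_trans; apply; apply: le_measure => //; rewrite inE.
  exact: measurableX.
exact: open_product_measurable Bbase oA.
Qed.

(** The complement of the closed [graph G] is a neighborhood of [z], in which local strictness of
    [F] finds a strict pair. *)
Lemma strict_disagreement (X : topologicalType) (F G : crel X) (z : X * X) :
  locally_strict F -> graph F z -> ~ graph G z ->
  exists u v, strictly F u v /\ ~ G u v.
Proof.
case: z => u v lsF Fz nGz.
have : nbhs (u, v) (~` graph G).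
  by apply: open_nbhs_nbhs; split => //; exact/closed_openC/graph_closed.
by move=> /(lsF _ _ Fz) [u' [v' [nG sF]]]; exists u', v'.
Qed.

Lemma open_disagreement (X : topologicalType) (F G : crel X) :
  preference F -> locally_strict F -> preference G -> locally_strict G ->
  F <> G -> exists O : set (X * X),
    [/\ open O, O !=set0 &
        forall z, O z -> strictly F z.1 z.2 /\ strictly G z.2 z.1 \/
                         strictly G z.1 z.2 /\ strictly F z.2 z.1].
Proof.
move=> pF lsF pG lsG FG.
(* Where [F'] lacks the reversed pair and [G'] lacks the pair itself, completeness makes both
   rankings strict and opposite; this condition is open because graphs are closed. *)
have gap F' G' z : preference F' -> locally_strict F' -> preference G' ->
    graph F' z -> ~ graph G' z -> exists O : set (X * X),
    [/\ open O, O !=set0 &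
        forall z, O z -> strictly F' z.1 z.2 /\ strictly G' z.2 z.1].
  move=> pF' lsF' pG' F'z nG'z.
  have [u [v [[_ nF2] nG']]] := strict_disagreement lsF' F'z nG'z.
  exists ([set z | (~` graph F') (z.2, z.1)] `&` ~` graph G'); split.
  - apply: openI; last exact/closed_openC/graph_closed.
    by apply: open_swap; exact/closed_openC/graph_closed.
  - by exists (u, v).
  - move=> [a b] /= [nF'ab nG'ab].
    by split; split=> //; [case: (pF' a b)|case: (pG' a b)].
have [z [[Fz nGz]|[Gz nFz]]] : exists z, graph F z /\ ~ graph G z \/
    graph G z /\ ~ graph F z.
  apply: contrapT => nz; apply: FG; apply: crel_eq; apply/seteqP.
  split=> z ?; apply: contrapT => ?; apply: nz; exists z; tauto.
- have [W [oW W0 WP]] := gap _ _ _ pF lsF pG Fz nGz.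
  by exists W; split => // z' /WP; left.
- have [W [oW W0 WP]] := gap _ _ _ pG lsG pF Gz nFz.
  by exists W; split => // z' /WP; right.
Qed.

(** * Expected error is smallest at the true preference *)

Section gap.
Context (R : realType) (X : ptopologicalType) (B : nat -> set X)
  (lambda : probability (borel X) R)
  (d : measure_display) (Omega : measurableType d) (Pr : probability Omega R).
Variables (x y : nat -> {RV Pr >-> borel X}) (c : nat -> {RV Pr >-> bool}).
Hypothesis Bbase : countable_base B.
Hypothesis supp : full_support lambda.
Hypothesis xy_iid : iid (draws x y) lambda.
Variables (P : set (crel X)) (q : crel X -> X -> X -> R) (Fstar : crel X).
Hypothesis P_pref : forall F, P F -> preference F /\ locally_strict F.
Hypothesis lambda_indiff : forall F, P F ->
  (lambda \x lambda)%E [set z : borel X * borel X | indifferent F z.1 z.2] = 0%E.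
Hypothesis q_error : error_probability P q.
Hypothesis P_Fstar : P Fstar.
Hypothesis c_drawn : choices_drawn x y c (q Fstar).

Local Notation XX := (borel X * borel X)%type.
Local Notation p := (q Fstar).

Lemma measurable_error_probability : measurable_fun [set: XX] (fun z => p z.1 z.2).
Proof. by have [] := q_error P_Fstar. Qed.

Lemma error_probability_itv u v : 0 <= p u v <= 1.
Proof. by have [] := q_error P_Fstar. Qed.

Lemma strictly_lt_half u v : strictly Fstar v u -> p u v < 1 / 2.
Proof.
move=> svu; have [_ _ half sym] := q_error P_Fstar.
have vu : v <> u by move=> vu; subst v; case: svu.
by rewrite (sym _ _ vu); have := half _ _ svu; lra.
Qed.

Lemma measurable_graph (F : crel X) : measurable (graph F : set XX).
Proof.
rewrite -[X in measurable X]setCK; apply: measurableC.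
apply: open_product_measurable Bbase _; exact/closed_openC/graph_closed.
Qed.

Lemma measurable_indifferent (F : crel X) :
  measurable ([set z | indifferent F z.1 z.2] : set XX).
Proof.
rewrite [X in measurable X](_ : _ = graph F `&` flip false (graph F)).
  by apply: measurableI; [|apply: measurable_flip]; exact: measurable_graph.
by apply/seteqP; split=> -[u v].
Qed.

Let disagreement (F : crel X) : set XX :=
  (graph F `\` graph Fstar) `|` (graph Fstar `\` graph F).

(* The expected excess of errors of F over Fstar at z, see [excessE]. *)
Let excess (F : crel X) (z : XX) : \bar R :=
  (\1_(disagreement F) z * `|2 * p z.1 z.2 - 1|)%:E.

Let measurable_excess F : measurable_fun [set: XX] (excess F).
Proof.
apply/measurable_EFinP; apply: measurable_funM.
  apply: measurable_indic.
  by apply: measurableU; apply: measurableD; exact: measurable_graph.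
apply: measurableT_comp => //; apply: measurable_funB => //.
by apply: measurable_funM => //; exact: measurable_error_probability.
Qed.

Let excess_ge0 F z : (0 <= excess F z)%E.
Proof. by rewrite lee_fin mulr_ge0. Qed.

(** Off indifference each relation errs exactly when the choice contradicts its ranking. Opposite
    rankings err with probabilities [w] and [1 - w], which differ by [|2w - 1|], and the smaller one
    belongs to [Fstar]. *)
Let excessE F z : P F -> ~ indifferent F z.1 z.2 ->
  ~ indifferent Fstar z.1 z.2 ->
  (flip_weight p (~` graph F) true z + flip_weight p (~` graph F) false z =
   flip_weight p (~` graph Fstar) true z +
   flip_weight p (~` graph Fstar) false z + excess F z)%E.
Proof.
case: z => u v PF nF nG; have [pF _] := P_pref PF.
have [pG _] := P_pref P_Fstar.
have [_ _ half _] := q_error P_Fstar.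
rewrite /flip_weight /excess -!EFinD; congr _%:E.
have half_lt : strictly Fstar v u -> p u v < 1 / 2 by exact: strictly_lt_half.
have {}half : strictly Fstar u v -> 1 / 2 < p u v by exact: half.
have inE' (A : set (X * X)) z : (z \in A) = `[< A z >] by [].
rewrite !indicE !inE' /flip /disagreement /=.
have Fuv := pF u v; have Guv := pG u v.
move: nF nG Fuv Guv half half_lt; rewrite /indifferent /strictly /relates /=.
set w : R := p u v.
(* By completeness and strictness each relation contains exactly one of the two ordered pairs, which
   leaves four cases. *)
have [Fu|nFu] := pselect (graph F (u, v));
  have [Fv|nFv] := pselect (graph F (v, u)); try tauto;
  have [Gu|nGu] := pselect (graph Fstar (u, v));
  have [Gv|nGv] := pselect (graph Fstar (v, u)); try tauto;
  move=> _ _ _ _ half half_lt.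
- rewrite (asboolF (P := ~ graph F (u, v)))// (asboolT (P := ~ graph F (v, u)))//.
  rewrite (asboolF (P := ~ graph Fstar (u, v)))// (asboolT (P := ~ graph Fstar (v, u)))//.
  rewrite asboolF; last by case=> -[].
  by rewrite /=; ring.
- rewrite (asboolF (P := ~ graph F (u, v)))// (asboolT (P := ~ graph F (v, u)))//.
  rewrite (asboolT (P := ~ graph Fstar (u, v)))// (asboolF (P := ~ graph Fstar (v, u)))//.
  rewrite asboolT; last by left.
  have := half_lt (conj Gv nGu) => wlt.
  rewrite ltr0_norm; last by lra.
  by rewrite /=; ring.
- rewrite (asboolT (P := ~ graph F (u, v)))// (asboolF (P := ~ graph F (v, u)))//.
  rewrite (asboolF (P := ~ graph Fstar (u, v)))// (asboolT (P := ~ graph Fstar (v, u)))//.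
  rewrite asboolT; last by right.
  have := half (conj Gu nGv) => wlt.
  rewrite gtr0_norm; last by lra.
  by rewrite /=; ring.
- rewrite (asboolT (P := ~ graph F (u, v)))// (asboolF (P := ~ graph F (v, u)))//.
  rewrite (asboolT (P := ~ graph Fstar (u, v)))// (asboolF (P := ~ graph Fstar (v, u)))//.
  rewrite asboolF; last by case=> -[].
  by rewrite /=; ring.
Qed.

(** If the integral vanished, [excess F] would be zero almost everywhere; but it is positive on an
    open set of opposite strict rankings, which has positive measure. *)
Let excess_gt0 F : P F -> F <> Fstar ->
  (0 < \int[problem_law x y]_z excess F z)%E.
Proof.
move=> PF FG; have [pF lsF] := P_pref PF; have [pG lsG] := P_pref P_Fstar.
have [W [oW W0 WP]] := open_disagreement pF lsF pG lsG FG.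
have mW := open_product_measurable Bbase oW.
rewrite lt_neqAle integral_ge0 ?andbT; last by move=> z _; exact: excess_ge0.
apply/negP => /eqP/esym int0.
have : (\int[problem_law x y]_z `|excess F z| = 0)%E.
  by rewrite -[RHS]int0; apply: eq_integral => z _; rewrite gee0_abs.
move=> /(ae_eq_integral_abs (problem_law x y) measurableT (measurable_excess F)).
move=> [N [mN N0 NP]].
have : (0 < problem_law x y W)%E.
  by rewrite (problem_lawE xy_iid)//; exact: (product_open_gt0 Bbase supp).
rewrite ltNge => /negP; apply; rewrite -[leRHS]N0.
apply: le_measure; rewrite ?inE// => z Wz; apply: NP => /= /(_ Logic.I).
case: z Wz => u v Wz; have [_ _ half _] := q_error P_Fstar.
have inD : (u, v) \in disagreement F.
  by rewrite inE /disagreement /=; case: (WP _ Wz) => [][[? ?] [? ?]]; tauto.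
rewrite /excess indicE inD mul1r => -[]/eqP; rewrite normr_eq0 => /eqP /=.
case: (WP _ Wz) => /= -[s1 s2].
  by have := strictly_lt_half s2; lra.
by have := half _ _ s1; lra.
Qed.

Lemma choice_law_fin_num A : measurable A ->
  choice_law x y p A \is a fin_num.
Proof.
move=> mA; rewrite -(distribution_chosen xy_iid measurable_error_probability
  error_probability_itv c_drawn 0)//.
rewrite fin_num_measure//; apply: measurable_preimageT mA.
exact: measurable_chosen.
Qed.

(** The identity [excessE] fails at most on the pairs indifferent for [F] or [Fstar], a null set, so
    integrating it leaves the positive integral of the excess. *)
Lemma choice_law_gap F : P F -> F <> Fstar ->
  (choice_law x y p (~` graph Fstar) < choice_law x y p (~` graph F))%E.
Proof.
move=> PF FG; have mgC G := measurableC (measurable_graph G).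
pose L (G : crel X) z :=
  (flip_weight p (~` graph G) true z + flip_weight p (~` graph G) false z)%E.
have mL G : measurable_fun [set: XX] (L G).
  apply: emeasurable_funD; apply: measurable_flip_weight => //;
    exact: measurable_error_probability.
have L0 G z : (0 <= L G z)%E.
  by apply: adde_ge0; apply: flip_weight_ge0; exact: error_probability_itv.
have indiff0 G : P G -> problem_law x y [set z | indifferent G z.1 z.2] = 0%E.
  move=> PG; rewrite (problem_lawE xy_iid); first exact: lambda_indiff.
  exact: measurable_indifferent.
have -> : choice_law x y p (~` graph F) =
    (choice_law x y p (~` graph Fstar) +
     \int[problem_law x y]_z excess F z)%E.
  rewrite /choice_law -ge0_integralD//.
  - apply: ge0_ae_eq_integral => //.
    + exact: mL.
    + by apply: emeasurable_funD => //; exact: mL.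
    + by move=> z _; exact: L0.
    + by move=> z _; apply: adde_ge0 => //; exact: L0.
    + exists ([set z | indifferent F z.1 z.2] `|`
              [set z | indifferent Fstar z.1 z.2]); split.
      * by apply: measurableU; exact: measurable_indifferent.
      * apply: null_set_setU;
          [exact: measurable_indifferent..|exact: indiff0|exact: indiff0].
      * move=> z /= nz; apply: contrapT => nI; apply: nz => _.
        by apply: excessE => // ?; apply: nI; [left|right].
  - by move=> z _; exact: L0.
  - exact: mL.
rewrite lteDl ?choice_law_fin_num//; exact: excess_gt0.
Qed.

End gap.

(** * Consistency *)

Section counting.
Context (T : choiceType) (f : nat -> T) (n : nat) (A : set T).

Let s := [seq f k | k <- iota 0 n & f k \notin A].

Let fset_setE : fset_set ([set f k | k in `I_n] `\` A) = [fset z in s]%fset.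
Proof.
have fin : finite_set ([set f k | k in `I_n] `\` A).
  by apply: finite_setD; exact: finite_image.
apply/fsetP => z; rewrite in_fset_set// in_fset.
apply/idP/mapP.
  rewrite inE => -[[k /= kn <-] nA]; exists k => //.
  by rewrite mem_filter mem_iota add0n leq0n kn !andbT notin_setE.
move=> [k]; rewrite mem_filter mem_iota add0n => /andP[/negP/[!inE] nA /= kn] ->.
by split => //; exists k.
Qed.

Let size_s (R : numDomainType) : (size s)%:R = \sum_(k < n) (f k \notin A)%:R :> R.
Proof.
rewrite size_map size_filter -sum1_count big_mkcond /=.
rewrite -[n in iota 0 n]subn0 -/(index_iota 0 n) big_mkord natr_sum.
by apply: eq_bigr => k _; case: (_ \notin _).
Qed.

(** A repeated value counts once in the set but each time in the sum, whence an inequality here and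
    injectivity in [card_image_setD]. *)
Lemma card_image_setD_le (R : numDomainType) :
  #|` fset_set ([set f k | k in `I_n] `\` A)|%:R <=
  \sum_(k < n) (f k \notin A)%:R :> R.
Proof. by rewrite fset_setE card_fseq -size_s ler_nat size_undup. Qed.

Lemma card_image_setD (R : numDomainType) : {in `I_n &, injective f} ->
  #|` fset_set ([set f k | k in `I_n] `\` A)|%:R =
  \sum_(k < n) (f k \notin A)%:R :> R.
Proof.
move=> finj; rewrite fset_setE card_fseq -size_s undup_id//.
rewrite map_inj_in_uniq ?filter_uniq ?iota_uniq// => i j.
rewrite !mem_filter !mem_iota !add0n => /andP[_ iN] /andP[_ jn].
by apply: finj; rewrite inE.
Qed.

End counting.

Lemma cvg_bigsetU0 (R : realType) (d : measure_display) (T : measurableType d)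
    (mu : {measure set T -> \bar R}) (E : nat -> nat -> set T) (m : nat) :
  (forall j n, measurable (E j n)) ->
  (forall j, mu (E j n) @[n --> \oo] --> 0%E) ->
  mu (\big[setU/set0]_(j < m) E j n) @[n --> \oo] --> 0%E.
Proof.
move=> mE cE; elim: m => [|m IH].
  rewrite (_ : (fun _ => _) = cst 0%E); first exact: cvg_cst.
  by apply/funext => n; rewrite big_ord0 measure0.
apply: (@squeeze_cvge _ _ _ _ (cst 0%E) _
  (fun n => (mu (\big[setU/set0]_(j < m) E j n) + mu (E m n))%E)).
- near=> n; apply/andP; split; first exact: measure_ge0.
  rewrite big_ord_recr /=; apply: measureU2 => //.
  exact: bigsetU_measurable.
- exact: cvg_cst.
- by rewrite -[0%E]adde0; apply: cvgeD.
Unshelve. all: by end_near. Qed.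

Section consistency.
Context (R : realType) (d : measure_display) (T : measurableType d)
  (Pr : probability T R).

(** The mean counts are [n * (r - p)] apart, so on the event at least one count deviates from its
    mean by half of that. No relation between [V] and [W] enters, as the two deviations are bounded
    separately. *)
Lemma hits_separation (V W : nat -> set T) (p r : R) :
  (forall k, measurable (V k)) -> (forall k, measurable (W k)) ->
  (forall k, Pr (V k) = p%:E) -> (forall k, Pr (W k) = r%:E) ->
  (forall k l, k <> l -> Pr (V k `&` V l) = (p * p)%:E) ->
  (forall k l, k <> l -> Pr (W k `&` W l) = (r * r)%:E) ->
  p < r ->
  Pr [set w | hits R W n w <= hits R V n w] @[n --> \oo] --> 0%E.
Proof.
move=> mV mW PV PW PV2 PW2 pr.
pose e := (r - p) / 2; have e0 : 0 < e by rewrite divr_gt0// subr_gt0.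
have mdev (U : nat -> set T) a n : (forall k, measurable (U k)) ->
    measurable [set w | n%:R * e <= `|hits R U n w - n%:R * a|].
  move=> mU; apply: measurable_le_set => //; apply: measurableT_comp => //.
  by apply: measurable_funB => //; exact: measurable_hits.
apply: (@squeeze_cvge _ _ _ _ (cst 0%E) _
  (fun n => (Pr [set w | n%:R * e <= `|hits R V n w - n%:R * p|]%R +
             Pr [set w | n%:R * e <= `|hits R W n w - n%:R * r|]%R)%E)).
- near=> n; apply/andP; split; first exact: measure_ge0.
  apply: le_trans (measureU2 _ (mdev V p n mV) (mdev W r n mW)).
  apply: le_measure; rewrite ?inE; last 2 first.
  + by apply: measurableU; exact: mdev.
  + move=> w /= WV; have [VW|VW] := leP (n%:R * e) (hits R V n w - n%:R * p).
      by left; apply: le_trans VW (ler_norm _).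
    right; rewrite distrC; apply: le_trans (ler_norm _).
    have : n%:R * r - n%:R * p = n%:R * e + n%:R * e.
      by rewrite /e -mulrBr -mulrDr; congr (_ * _); lra.
    lra.
  + by apply: measurable_le_set; exact: measurable_hits.
- exact: cvg_cst.
- by rewrite -[0%E]adde0; apply: cvgeD => //; exact: weak_law.
Unshelve. all: by end_near. Qed.

End consistency.

Unset Implicit Arguments.

Theorem theorem2 (R : realType) (X : ptopologicalType)
  (X_lc : locally_compact [set: X])
  (X_sep : separable X)
  (X_cm : completely_metrizable R X)
  (P : set (crel X))
  (P_closed : closed P)
  (P_pref : forall F, P F -> preference F /\ locally_strict F)
  (rho : crel X -> crel X -> R)
  (rho_compatible : compatible_metric rho)
  (lambda : probability (borel X) R)
  (lambda_supp : full_support lambda)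
  (lambda_indiff : forall F, P F ->
     (lambda \x lambda)%E
       [set z : borel X * borel X | indifferent F z.1 z.2] = 0%E)
  (q : crel X -> X -> X -> R)
  (q_error : error_probability P q)
  (Fstar : crel X)
  (P_Fstar : P Fstar)
  (d : measure_display) (Omega : measurableType d) (Pr : probability Omega R)
  (x y : nat -> {RV Pr >-> borel X})
  (c : nat -> {RV Pr >-> bool})
  (xy_iid : iid (draws x y) lambda)
  (c_drawn : choices_drawn x y c (q Fstar))
  (est : nat -> Omega -> crel X)
  (est_kemeny : forall n w, (0 < n)%N ->
     kemeny_minimizing R P n (revealed x y c n w) (est n w))
  (eta : R) (eta_gt0 : 0 < eta) :
  inner_probability Pr [set w | rho (est n w) Fstar < eta] @[n --> \oo]
    --> 1%E.
Proof.
have [dX [dX_compat _]] := X_cm.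
have [B Bbase] := separable_countable_base dX_compat X_sep.
have [f fbase] := prod_countable_base Bbase Bbase.
have mp := measurable_error_probability q_error P_Fstar.
have p01 := error_probability_itv q_error P_Fstar.
have mopen (A : set (X * X)) : open A -> measurable (A : set (borel X * borel X)).
  exact: open_product_measurable Bbase.
have mgC (F : crel X) : measurable (~` graph F : set (borel X * borel X)).
  by apply: mopen; exact/closed_openC/graph_closed.
pose Z := chosen x y c.
have mZ k : measurable_fun [set: Omega] (Z k) by exact: measurable_chosen.
(* The choice law as a genuine probability, as continuity from below requires a measure. *)
pose mu : probability (borel X * borel X)%type R :=
  distribution Pr (to_mfun (mZ 0%N)).
have muE A : measurable A -> mu A = choice_law x y (q Fstar) A.
  exact: (distribution_chosen xy_iid mp p01 c_drawn).
pose L A := fine (mu A).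
have PZ A : measurable A -> forall k, Pr (Z k @^-1` A) = (L A)%:E.
  move=> mA k; rewrite /L fineK ?fin_num_measure// muE//.
  exact: (distribution_chosen xy_iid mp p01 c_drawn).
have PZ2 A : measurable A -> forall k l, k <> l ->
    Pr (Z k @^-1` A `&` Z l @^-1` A) = (L A * L A)%:E.
  move=> mA k l kl; rewrite EFinM /L fineK ?fin_num_measure// muE//.
  exact: (chosen_independent xy_iid mp p01 c_drawn).
have mZA A k : measurable A -> measurable (Z k @^-1` A).
  by move=> mA; apply: measurable_preimageT mA.
(* The distant preferences; [K] is closed, so it keeps the limits of its sequences. *)
pose K := P `&` [set F | eta <= rho F Fstar].
have [[rho_ge0 rho_eq0 rho_sym rho_tri] _] := rho_compatible.
have K_closed : closed K.
  apply: closedI => //; rewrite (_ : [set F | _] = ~` [set F | rho Fstar F < eta]).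
    by apply: open_closedC; exact: open_metric_ball.
  by apply/seteqP; split=> F /=; rewrite (rho_sym Fstar) leNgt => /negP.
have K0 F : K F -> graph F !=set0.
  by move=> [/P_pref[pF _] _]; exists (point, point); case: (pF point point).
have Kgap F : K F -> (mu (~` graph Fstar) < mu (~` graph F))%E.
  move=> [PF /= FF]; rewrite !muE//.
  apply: (choice_law_gap Bbase lambda_supp xy_iid P_pref lambda_indiff q_error
    P_Fstar c_drawn) => // FE.
  by move: FF; rewrite FE (rho_eq0 _ _).2// leNgt eta_gt0.
have [A [m Acover]] := finite_separating_opens fbase (mu := mu)
  (fun i => mopen _ (fbase.1 i)) K_closed K0 Kgap.
(* Off ties the chosen pairs are distinct: a repeated pair repeats a draw, and
   Fstar is indifferent between equal alternatives. *)
pose ties := \bigcup_(ij in [set ij : (nat + nat) * (nat + nat) | ij.1 != ij.2])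
  [set w | indifferent Fstar (draws x y ij.1 w) (draws x y ij.2 w)].
have mindiff := measurable_indifferent Bbase Fstar.
have tie0 (i j : nat + nat) : i != j ->
    measurable [set w | indifferent Fstar (draws x y i w) (draws x y j w)] /\
    Pr [set w | indifferent Fstar (draws x y i w) (draws x y j w)] = 0%E.
  move=> ij; split; last first.
    have := pair_law xy_iid ij mindiff; rewrite lambda_indiff//.
  have : measurable_fun [set: Omega]
      (fun w => (draws x y i w, draws x y j w) : borel X * borel X).
    by apply: measurable_fun_pair; exact: measurable_funP.
  by move=> /(_ measurableT _ mindiff); rewrite setTI.
have [N [mN N0 tiesN]] : Pr.-negligible ties.
  pose tie (ij : (nat + nat) * (nat + nat)) :=
    [set w | ij.1 != ij.2 /\
      indifferent Fstar (draws x y ij.1 w) (draws x y ij.2 w)].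
  (* The ties are reindexed by the codes of pairs of draws, as a countable union of null events. *)
  apply: (@negligibleS _ _ _ _
      (\bigcup_n (if choice.unpickle n is Some ij then tie ij else set0))).
    move=> w [ij ijne wij]; exists (choice.pickle ij) => //.
    by rewrite choice.pickleK.
  apply: negligible_bigcup => n; case: choice.unpickle => [ij|].
    have [ij0|ijne] := eqVneq ij.1 ij.2.
      rewrite (_ : tie ij = set0); first exact: negligible_set0.
      by apply/seteqP; split=> // w []; rewrite ij0 eqxx.
    have [mt t0] := tie0 _ _ ijne.
    apply: negligibleS ((negligibleP _ mt).2 t0).
    by move=> w [].
  exact: negligible_set0.
have Zinj w : ~ N w -> injective (Z ^~ w).
  move=> nNw i j Zij; apply: contrapT => /eqP ij.
  suff [I [J [IJ eqIJ]]] : exists I J, I != J /\ draws x y I w = draws x y J w.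
    apply/nNw/tiesN; exists (I, J) => //=; rewrite eqIJ.
    have [pF _] := P_pref _ P_Fstar.
    by split; case: (pF (draws x y J w) (draws x y J w)).
  (* The chosen alternative is one of the two draws of its own problem, so different problems give
     different indices. *)
  have ex k : exists2 I : nat + nat, (I == inl k) || (I == inr k) &
      draws x y I w = (Z k w).1.
    by rewrite /Z /chosen; case: (c k w); [exists (inl k)|exists (inr k)];
      rewrite ?eqxx ?orbT.
  have [I Ii Ieq] := ex i; have [J Jj Jeq] := ex j.
  exists I, J; split; last by rewrite Ieq Jeq Zij.
  by case/orP: Ii => /eqP->; case/orP: Jj => /eqP->.
have revealedE n w : revealed x y c n w = [set Z k w | k in `I_n].
  by apply/seteqP; split=> z [k kn]; [move=> ->|move=> <-]; exists k.
pose W A k := Z k @^-1` A.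
(* Only some of the first [m] sets need be open and heavy enough for the law of large numbers; the
   others get an empty bad event. *)
pose relevant j := `[< open (A j) /\ (mu (~` graph Fstar) < mu (A j))%E >].
pose bad j n := if relevant j
  then [set w | hits R (W (A j)) n w <= hits R (W (~` graph Fstar)) n w]
  else set0.
have mbad j n : measurable (bad j n).
  rewrite /bad; case: ifP => [/asboolP[oA _]|//].
  apply: measurable_le_set.
    by apply: measurable_hits => k; apply: mZA; exact: mopen.
  by apply: measurable_hits => k; exact: mZA.
have bad0 j : Pr (bad j n) @[n --> \oo] --> 0%E.
  rewrite /bad; case Rj : (relevant j); last first.
    by rewrite measure0; exact: cvg_cst.
  have [oA gtA] := asboolW Rj; have mAj := mopen _ oA.
  apply: (hits_separation (p := L (~` graph Fstar)) (r := L (A j))).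
  - by move=> k; exact: mZA.
  - by move=> k; exact: mZA.
  - exact: PZ.
  - exact: PZ.
  - exact: PZ2.
  - exact: PZ2.
  - by rewrite -lte_fin /L !fineK ?fin_num_measure.
have good n w : (0 < n)%N -> ~ N w -> (forall j, (j < m)%N -> ~ bad j n w) ->
    rho (est n w) Fstar < eta.
  move=> n0 nN nbad; rewrite ltNge; apply/negP => far.
  have [Pest kmin] := est_kemeny n w n0.
  have [j jm [oA gtA Asub]] := Acover _ (conj Pest far).
  have := nbad j jm; rewrite /bad (_ : relevant j = true); last first.
    by apply/asboolP.
  move=> /negP; rewrite -ltNge => hlt.
  have := kmin _ P_Fstar; rewrite /kemeny_distance ler_pM2r ?invr_gt0 ?ltr0n//.
  apply/negP; rewrite -ltNge revealedE.
  (* The errors of [Fstar] number at most its hits, which are fewer than the hits of [A j], all of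
     them errors of the estimate. Distinctness of the chosen pairs ensures that the latter are not
     merged in the set. *)
  apply: le_lt_trans (card_image_setD_le _ _ _ _) _.
  rewrite card_image_setD; last by move=> i i' _ _; exact: Zinj.
  apply: le_lt_trans (_ : _ <= hits R (W (~` graph Fstar)) n w) _.
    apply: ler_sum => k _; rewrite indicE ler_nat.
    have [nF|//] := boolP (Z k w \notin graph Fstar).
    by move: nF; rewrite notin_setE => nF; rewrite (_ : w \in _)// inE.
  apply: lt_le_trans hlt _; apply: ler_sum => k _; rewrite indicE ler_nat.
  have [/set_mem wA|//] := boolP (w \in _).
  by rewrite (_ : Z k w \notin _)// notin_setE; exact: Asub.
pose Bad n := \big[setU/set0]_(j < m) bad j n.
have mBad n : measurable (Bad n) by exact: bigsetU_measurable.
apply: (@squeeze_cvge _ _ _ _ (fun n => (1 - Pr (Bad n))%E) _ (cst 1%E)).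
- near=> n; apply/andP; split; last first.
    by apply: ge_ereal_sup => _ [E [mE _] <-]; exact: probability_le1.
  apply: le_trans (_ : _ <= Pr (~` (N `|` Bad n)))%E _.
    rewrite probability_setC; last exact: measurableU.
    apply: leeB => //; rewrite -[leRHS]add0e -N0; exact: measureU2.
  (* A measurable event inside the possibly nonmeasurable one, witnessing the inner probability. *)
  apply: ereal_sup_ubound; exists (~` (N `|` Bad n)) => //; split.
    by apply: measurableC; exact: measurableU.
  move=> w /= nNB; apply: good.
  + by near: n; exact: nbhs_infty_gt.
  + by move=> Nw; apply: nNB; left.
  + move=> j jm bj; apply: nNB; right.
    by rewrite /Bad -(bigcup_mkord m (bad ^~ n)); exists j.
- rewrite -[X in _ --> X]sube0; apply: cvgeB => //; first exact: cvg_cst.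
  exact: cvg_bigsetU0.
- exact: cvg_cst.
Unshelve. all: by end_near. Qed.
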